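(* Let $K$ be a compact and symmetric subset of $\mathbb{T}\setminus\{1\}$, and assume that $\mathbf{a}\in\mathcal{D}'(K)$ is an even distribution. Then for every $N\ge 1$ $$\det T_{2N}(\mathbf{a}\boldsymbol{\sigma}) = \bigl(\det M_N(\mathbf{a})\bigr)^2 .$$ Moreover, $\mathbf{c}=\mathbf{a}\boldsymbol{\sigma}\in\mathcal{D}'(K\cup\{1\})$ is an odd distribution.
   Context: $\mathbb{T}$ is the unit circle, $\mathcal{D}=C^\infty(\mathbb{T})$, and $\mathcal{D}'$ is the space of distributions on $\mathbb{T}$ (continuous linear functionals on $\mathcal{D}$). The Fourier coefficients of $\mathbf{a}\in\mathcal{D}'$ are $\mathbf{a}_n=\mathbf{a}(\chi_{-n})$ with $\chi_n(t)=t^n$; $\mathcal{D}'$ corresponds bijectively to at most polynomially increasing sequences of Fourier coefficients. A function $a\in L^1(\mathbb{T})$ is identified with the distribution $f\mapsto \frac1{2\pi}\int_0^{2\pi}a(e^{i\theta})f(e^{i\theta})\,d\theta$. For $g\in\mathcal{D}$, $\mathbf{b}\in\mathcal{D}'$, the product is $(g\mathbf{b})(f)=\mathbf{b}(gf)$. For compact $K\subseteq\mathbb{T}$, $C^\infty(\mathbb{T}\setminus K)$ is the set of infinitely differentiable functions on $\mathbb{T}\setminus K$, and $C^\infty_K(\mathbb{T})$ is the set of $f\in\mathcal{D}$ vanishing on an open neighborhood of $K$. If $g\in C^\infty(\mathbb{T}\setminus K)$ and $f\in C_K^\infty(\mathbb{T})$, then $gf\in C^\infty_K(\mathbb{T})$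 (extended by $0$ on $K$). $\mathcal{D}'(K)$ is the set of $\mathbf{a}\in\mathcal{D}'$ for which there is $a\in C^\infty(\mathbb{T}\setminus K)$ with $\mathbf{a}(f)=\frac1{2\pi}\int_0^{2\pi}a(e^{i\theta})f(e^{i\theta})\,d\theta$ for all $f\in C^\infty_K(\mathbb{T})$; this $a$ is called the smooth part of $\mathbf{a}$. If $M,L$ are disjoint compact subsets of $\mathbb{T}$, $\mathbf{a}\in\mathcal{D}'(M)$, $\mathbf{b}\in\mathcal{D}'(L)$ have smooth parts $a,b$, then $\mathbf{a}\mathbf{b}:=(bf_b)\mathbf{a}+(af_a)\mathbf{b}\in\mathcal{D}'(M\cup L)$, where $f_a\in C^\infty_M(\mathbb{T})$, $f_b\in C^\infty_L(\mathbb{T})$, $f_a+f_b=1$ (the result does not depend on the choice). For $\mathbf{a}\in\mathcal{D}'$, $\tilde{\mathbf{a}}$ is the distribution with $\tilde{\mathbf{a}}_{n}=\mathbf{a}_{-n}$; $\mathbf{a}$ is even (odd) if $\tilde{\mathbf{a}}=\mathbf{a}$ ($\tilde{\mathbf{a}}=-\mathbf{a}$). $K\subseteq\mathbb{T}$ is symmetric if $t\in K\Leftrightarrow t^{-1}\in K$. $\boldsymbol{\sigma}$ is the distribution with Fourier coefficients $\boldsymbol{\sigma}_n=\mathrm{sign}(n)$ ($\mathrm{sign}(0)=0$); it belongs to $\mathcal{D}'(\{1\})$ with smooth part $\sigma(t)=\frac{1+t}{1-t}$. For $\mathbf{a}\in\mathcal{D}'$: $T_N(\mathbf{a})=(\mathbf{a}_{j-k})_{j,k=0}^{N-1}$,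 $H_N(\mathbf{a})=(\mathbf{a}_{j+k+1})_{j,k=0}^{N-1}$, $M_N(\mathbf{a})=T_N(\mathbf{a})+H_N(\mathbf{a})$. *)

(* Defs.v *)
From HB Require Import structures.
From mathcomp Require Import all_boot all_order all_algebra.
From mathcomp Require Import all_classical all_reals all_analysis.
From mathcomp Require Import complex.

Set Implicit Arguments.
Unset Strict Implicit.
Unset Printing Implicit Defensive.

Import Order.TTheory GRing.Theory Num.Theory.
Import numFieldNormedType.Exports.

Local Open Scope ring_scope.
Local Open Scope classical_set_scope.

Definition unit_circle (R : realType) : set R[i]^o := [set z | `|z| = 1].
Arguments unit_circle : clear implicits.

Notation circle R := (set_type (unit_circle R)).

Section Circle.
Context {R : realType}.

Lemma expi_subproof (x : R) :
  ((cos x +i* sin x)%C : R[i]^o) \in unit_circle R.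
Proof.
rewrite inE /unit_circle /=.
have -> : `|(cos x +i* sin x)%C : R[i]^o| = `|(cos x +i* sin x)%C| by [].
by rewrite normc_def /= cos2Dsin2 sqrtr1.
Qed.

Definition expi (x : R) : circle R := SigSub (expi_subproof x).

Lemma circle_inv_subproof (t : circle R) :
  (((val t : R[i])^-1 : R[i]^o)) \in unit_circle R.
Proof.
have := valP t; rewrite !inE /unit_circle /= => t1.
have -> : `|((val t : R[i])^-1 : R[i]^o)| = `|(val t : R[i])^-1| by [].
by rewrite normfV t1 invr1.
Qed.

Definition circle_inv (t : circle R) : circle R :=
  SigSub (circle_inv_subproof t).

Lemma circle_one_subproof : (1 : R[i]^o) \in unit_circle R.
Proof. by rewrite inE /unit_circle /= normr1. Qed.

Definition circle_one : circle R := SigSub circle_one_subproof.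

Definition circle_sym (K : set (circle R)) : Prop :=
  forall t, K t <-> K (circle_inv t).

(* R[i] carries no structure of normed module over R, so derivatives in the
   angle, and integrals below, are taken componentwise. *)
Definition cderiven (n : nat) (g : R -> R[i]^o) (x : R) : R[i]^o :=
  ((fun y => complex.Re (g y))^`(n) x +i* (fun y => complex.Im (g y))^`(n) x)%C.

(* f is C^oo on the complement of K (meant for closed K), as a function of the
   angle; the values of f on K are junk. *)
Definition smooth_off (K : set (circle R)) (f : circle R -> R[i]^o) : Prop :=
  forall (n : nat) (x : R), ~ K (expi x) ->
    derivable (fun y => complex.Re (f (expi y)))^`(n) x 1 /\
    derivable (fun y => complex.Im (f (expi y)))^`(n) x 1.

(* (1 / 2pi) * integral of g(e^(ix)) over [0, 2pi] *)
Definition circle_mean (g : circle R -> R[i]^o) : R[i]^o :=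
  (((2 * pi)^-1 * \int[lebesgue_measure]_(x in `[0%R, 2 * pi])
      complex.Re (g (expi x))) +i*
   ((2 * pi)^-1 * \int[lebesgue_measure]_(x in `[0%R, 2 * pi])
      complex.Im (g (expi x))))%C.

End Circle.

Section SmoothReal.
Context {R : realType}.
Implicit Types f g : R -> R.

Let Cn n f := forall k x, (k <= n)%N -> derivable f^`(k) x 1.

Let CnS n f : Cn n.+1 f <-> (forall x, derivable f x 1) /\ Cn n f^`().
Proof.
split=> [H|[H0 H] [|k] x kn]; last 2 first.
- exact: H0.
- by rewrite derive1Sn; apply: H.
split=> [x|k x kn]; first exact: (H 0%N x).
by rewrite -derive1Sn; apply: H.
Qed.

Let CnW n f : Cn n.+1 f -> Cn n f.
Proof. by move=> H k x kn; apply: H; apply: leqW. Qed.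

Let CnD n f g : Cn n f -> Cn n g -> Cn n (f \+ g).
Proof.
elim: n f g => [|n IH] f g.
  move=> Hf Hg [|//] x _; apply: derivableD; [exact: (Hf 0%N)|exact: (Hg 0%N)].
move=> /CnS[f0 f1] /CnS[g0 g1]; apply/CnS; split=> [x|].
  by apply: derivableD.
have -> : (f \+ g)^`() = f^`() \+ g^`(); last exact: IH.
by apply/funext => x; rewrite /= !derive1E deriveD.
Qed.

Let CnM n f g : Cn n f -> Cn n g -> Cn n (f \* g).
Proof.
elim: n f g => [|n IH] f g.
  move=> Hf Hg [|//] x _; apply: derivableM; [exact: (Hf 0%N)|exact: (Hg 0%N)].
move=> Hf Hg; have /CnS[f0 f1] := Hf; have /CnS[g0 g1] := Hg.
apply/CnS; split=> [x|]; first by apply: derivableM.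
have -> : (f \* g)^`() = (f \* g^`()) \+ (g \* f^`()).
  by apply/funext => x; rewrite /= !derive1E deriveM.
by apply: CnD; [exact: (IH _ _ (CnW Hf) g1)|exact: (IH _ _ (CnW Hg) f1)].
Qed.

Definition smoothr f := forall n x, derivable f^`(n) x 1.

Let smoothrE f : smoothr f <-> forall n, Cn n f.
Proof. by split=> [H n k x _|H n x]; [exact: H|exact: (H n n)]. Qed.

Lemma smoothrD f g : smoothr f -> smoothr g -> smoothr (f \+ g).
Proof.
by move=> /smoothrE Hf /smoothrE Hg; apply/smoothrE => n; apply: CnD.
Qed.

Lemma smoothrM f g : smoothr f -> smoothr g -> smoothr (f \* g).
Proof.
by move=> /smoothrE Hf /smoothrE Hg; apply/smoothrE => n; apply: CnM.
Qed.

Lemma smoothr_cst (a : R) : smoothr (fun=> a).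
Proof.
have H n : exists b : R, (fun=> a : R)^`(n) = fun=> b.
  elim: n => [|n [b IH]]; first by exists a.
  by exists 0; rewrite derive1nS IH; apply/funext => x; rewrite derive1_cst.
by move=> n x; have [b ->] := H n; apply: derivable_cst.
Qed.

Lemma smoothrN f : smoothr f -> smoothr (fun x => - f x).
Proof.
move=> Hf; have -> : (fun x => - f x) = (fun=> -1) \* f.
  by apply/funext => x /=; rewrite mulN1r.
by apply: smoothrM; [exact: smoothr_cst|].
Qed.

Lemma smoothr_cos_sin : smoothr cos /\ smoothr sin.
Proof.
have H n : Cn n cos /\ Cn n sin.
  elim: n => [|n [IHc IHs]].
    by split => -[|//] x _; [exact: derivable_cos|exact: derivable_sin].
  have dcos : cos^`() = (fun=> -1) \* (@sin R).
    apply/funext => x; rewrite derive1E /= mulN1r.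
    by apply: derive_val.
  have dsin : sin^`() = @cos R.
    by apply/funext => x; rewrite derive1E; apply: derive_val.
  split; apply/CnS.
    split=> [x|]; first exact: derivable_cos.
    have /smoothrE H : smoothr (fun=> -1) by exact: smoothr_cst.
    by rewrite dcos; exact: (CnM (H n) IHs).
  by split=> [x|]; [exact: derivable_sin|rewrite dsin].
by split; apply/smoothrE => n; have [] := H n.
Qed.

End SmoothReal.

Section Smooth.
Context {R : realType}.
Implicit Types f g : circle R -> R[i]^o.

Let smoothE f : smooth_off set0 f <->
  smoothr (fun y => complex.Re (f (expi y))) /\
  smoothr (fun y => complex.Im (f (expi y))).
Proof.
split=> [H|[H1 H2] n x _]; last by split; [exact: H1|exact: H2].
by split=> n x; [exact: (H n x id).1|exact: (H n x id).2].
Qed.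

Lemma smooth_cst (a : R[i]^o) : smooth_off set0 (fun=> a).
Proof. by apply/smoothE; split; exact: smoothr_cst. Qed.

Lemma smoothD f g : smooth_off set0 f -> smooth_off set0 g ->
  smooth_off set0 (fun t => f t + g t).
Proof.
move=> /smoothE[f1 f2] /smoothE[g1 g2]; apply/smoothE; split.
- have -> : (fun y => complex.Re (f (expi y) + g (expi y))) =
    (fun y => complex.Re (f (expi y))) \+ (fun y => complex.Re (g (expi y))).
    by apply/funext => y /=; rewrite [LHS]raddfD.
  exact: smoothrD.
- have -> : (fun y => complex.Im (f (expi y) + g (expi y))) =
    (fun y => complex.Im (f (expi y))) \+ (fun y => complex.Im (g (expi y))).
    by apply/funext => y /=; rewrite [LHS]raddfD.
  exact: smoothrD.
Qed.

Lemma smoothM f g : smooth_off set0 f -> smooth_off set0 g ->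
  smooth_off set0 (fun t => f t * g t).
Proof.
move=> /smoothE[f1 f2] /smoothE[g1 g2]; apply/smoothE; split.
- have -> : (fun y => complex.Re (f (expi y) * g (expi y))) =
    ((fun y => complex.Re (f (expi y))) \* (fun y => complex.Re (g (expi y))))
    \+ (fun y => - (complex.Im (f (expi y)) * complex.Im (g (expi y)))).
    by apply/funext => y /=; case: (f _) (g _) => [a b] [c d].
  apply: smoothrD; first exact: smoothrM.
  exact: smoothrN (smoothrM f2 g2).
- have -> : (fun y => complex.Im (f (expi y) * g (expi y))) =
    ((fun y => complex.Re (f (expi y))) \* (fun y => complex.Im (g (expi y))))
    \+ ((fun y => complex.Im (f (expi y))) \* (fun y => complex.Re (g (expi y)))).
    by apply/funext => y /=; case: (f _) (g _) => [a b] [c d].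
  by apply: smoothrD; exact: smoothrM.
Qed.

Lemma smooth_val : smooth_off set0 (fun t : circle R => val t).
Proof.
have [c s] := @smoothr_cos_sin R.
by apply/smoothE; split; [exact: c|exact: s].
Qed.

Lemma smooth_valV : smooth_off set0 (fun t : circle R => (val t)^-1).
Proof.
have [c s] := @smoothr_cos_sin R.
apply/smoothE; split.
- have -> : (fun y => complex.Re (val (@expi R y))^-1) = cos.
    apply/funext => y.
    rewrite [LHS](_ : _ = cos y / (cos y ^+ 2 + sin y ^+ 2))//.
    by rewrite cos2Dsin2 divr1.
  exact: c.
- have -> : (fun y => complex.Im (val (@expi R y))^-1) = (fun y => - sin y).
    apply/funext => y.
    rewrite [LHS](_ : _ = - (sin y / (cos y ^+ 2 + sin y ^+ 2)))//.
    by rewrite cos2Dsin2 divr1.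
  exact: smoothrN.
Qed.

Lemma smooth_exprz (n : int) : smooth_off set0 (fun t : circle R => val t ^ n).
Proof.
case: n => n.
- elim: n => [|n IH]; first exact: smooth_cst.
  have -> : (fun t : circle R => val t ^ n.+1) =
    (fun t => val t * val t ^ n).
    by apply/funext => t; rewrite -!exprnP exprS.
  exact: smoothM smooth_val IH.
- elim: n => [|n IH].
    have -> : (fun t : circle R => val t ^ Negz 0) = (fun t => (val t)^-1).
      by apply/funext => t.
    exact: smooth_valV.
  have -> : (fun t : circle R => val t ^ Negz n.+1) =
    (fun t => (val t)^-1 * val t ^ Negz n).
    apply/funext => t; rewrite -[LHS]/((val t ^+ n.+2)^-1).
    by rewrite -[val t ^ Negz n]/((val t ^+ n.+1)^-1) -!exprVn exprS.
  exact: smoothM smooth_valV IH.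
Qed.

End Smooth.

Definition is_smooth (R : realType) : {pred circle R -> R[i]^o} :=
  fun f => `[< smooth_off set0 f >].

Lemma is_smooth_submod (R : realType) : submod_closed (@is_smooth R).
Proof.
split=> [|k f g /asboolP Hf /asboolP Hg]; apply/asboolP.
  exact: smooth_cst.
exact: (smoothD (smoothM (smooth_cst k) Hf) Hg).
Qed.

HB.instance Definition _ (R : realType) :=
  GRing.isSubmodClosed.Build R[i] (circle R -> R[i]^o) (@is_smooth R)
    (@is_smooth_submod R).

(* D = C^oo(T) *)
Record test_fun (R : realType) := TestFun {
  test_val :> circle R -> R[i]^o;
  _ : test_val \in @is_smooth R }.

HB.instance Definition _ (R : realType) := [isSub for @test_val R].
HB.instance Definition _ (R : realType) := [Choice of test_fun R by <:].
HB.instance Definition _ (R : realType) :=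
  [SubChoice_isSubLmodule of test_fun R by <:].

Definition test_deriv (R : realType) (n : nat) (f : test_fun R) :
  {uniform R -> R[i]^o} := cderiven n (f \o expi).

(* The Frechet topology of C^oo: uniform convergence of every derivative. *)
HB.instance Definition _ (R : realType) :=
  Topological.copy (test_fun R)
    (sup_topology (fun n : nat =>
       Topological.on (initial_topology (@test_deriv R n)))).

(* D' *)
Record circle_dist (R : realType) := CircleDist {
  dist_fun :> {linear test_fun R -> R[i]^o};
  dist_continuous : continuous dist_fun }.

HB.instance Definition _ (R : realType) := gen_eqMixin (circle_dist R).
HB.instance Definition _ (R : realType) := gen_choiceMixin (circle_dist R).

Section Distributions.
Context {R : realType}.
Implicit Types (K M L : set (circle R)) (f g h : test_fun R).
Implicit Types (a b c : circle_dist R) (s : circle R -> R[i]^o).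

Lemma test_smooth f : smooth_off set0 f.
Proof. by have /asboolP := valP f. Qed.

Definition test_of s (hs : smooth_off set0 s) : test_fun R :=
  TestFun (introT (asboolP _) hs : s \in @is_smooth R).

Definition test_mul f g : test_fun R :=
  test_of (smoothM (test_smooth f) (test_smooth g)).

Definition chi (n : int) : test_fun R := test_of (smooth_exprz n).

Definition fourier a (n : int) : R[i] := a (chi (- n)).

Lemma dist_zero_continuous :
  continuous (\0 : {linear test_fun R -> R[i]^o}).
Proof. by move=> f; exact: (@cst_continuous _ _ (0 : R[i]^o)). Qed.

Definition dist_zero : circle_dist R := CircleDist dist_zero_continuous.

Lemma dist_opp_continuous a :
  continuous (\- a : {linear test_fun R -> R[i]^o}).
Proof. by move=> f; exact: (cvgN (@dist_continuous R a f)). Qed.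

Definition dist_opp a : circle_dist R := CircleDist (@dist_opp_continuous a).

(* The distribution with Fourier coefficients [u]; such a distribution is
   unique, and it exists iff [u] grows at most polynomially. *)
Definition dist_of_fourier (u : int -> R[i]) : circle_dist R :=
  xget dist_zero [set a | forall n, fourier a n = u n].

Definition dist_reflect a : circle_dist R :=
  dist_of_fourier (fun n => fourier a (- n)).

Definition dist_even a : Prop := dist_reflect a = a.
Definition dist_odd a : Prop := dist_reflect a = dist_opp a.

Definition vanishes_near K f : Prop :=
  exists U : set (circle R), [/\ open U, K `<=` U & forall t, U t -> f t = 0].

(* The values of [s] on [K] are irrelevant: there [f] vanishes, so that
   [s t * f t] is the extension by zero. *)
Definition smooth_part K a s : Prop :=
  smooth_off K s /\
  forall f, vanishes_near K f -> a f = circle_mean (fun t => s t * f t).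

(* D'(K) *)
Definition smooth_outside K a : Prop := exists s, smooth_part K a s.

(* c = (sb fb) a + (sa fa) b *)
Definition is_dist_mul M L a b c : Prop :=
  exists (sa sb : circle R -> R[i]^o) (fa fb ga gb : test_fun R),
    [/\ smooth_part M a sa /\ smooth_part L b sb,
        vanishes_near M fa /\ vanishes_near L fb,
        forall t, fa t + fb t = 1,
        (forall t, ga t = sa t * fa t) /\ (forall t, gb t = sb t * fb t)
      & forall h, c h = a (test_mul gb h) + b (test_mul ga h)].

(* Meaningful for disjoint compact [M] and [L] with [a] smooth outside [M]
   and [b] smooth outside [L]: then there is exactly one such [c]. *)
Definition dist_mul M L a b : circle_dist R :=
  xget dist_zero [set c | is_dist_mul M L a b c].

Definition sigma : circle_dist R := dist_of_fourier (fun n => (sgz n)%:~R).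

Definition toeplitz_mx (N : nat) a : 'M[R[i]]_N :=
  \matrix_(j < N, k < N) fourier a (j%:Z - k%:Z).

Definition hankel_mx (N : nat) a : 'M[R[i]]_N :=
  \matrix_(j < N, k < N) fourier a (j + k + 1)%N%:Z.

(* M_N(a) = T_N(a) + H_N(a) *)
Definition toeplitz_hankel_mx (N : nat) a : 'M[R[i]]_N :=
  toeplitz_mx N a + hankel_mx N a.

End Distributions.

(* Main.v *)
Require Import Defs.
From HB Require Import structures.
From mathcomp Require Import all_boot all_order all_algebra.
From mathcomp Require Import all_classical all_reals all_analysis.
From mathcomp Require Import complex.
From mathcomp Require Import perm ring lra zify.

Set Implicit Arguments.
Unset Strict Implicit.
Unset Printing Implicit Defensive.

Import Order.TTheory GRing.Theory Num.Theory.
Import numFieldNormedType.Exports.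

Local Open Scope ring_scope.
Local Open Scope classical_set_scope.

(* Write sigma as the principal value of its smooth part (1 + t) / (1 - t).  The
   product c = a sigma then satisfies (1 - t) c = (1 + t) a, that is
   c_n - c_(n-1) = a_n + a_(n-1); as a is even, c_(-n) + c_n does not depend on
   n, and it vanishes at n = 0: averaging the definition of c_0 over a partition
   of unity and its reflection leaves two integrals of the smooth parts that
   cancel.  So c is odd, and with t = T_N(c) and h = H_N(c) the matrix T_2N(c)
   is, up to reversing the first N indices, the block matrix [-t, -h; h, t], of
   determinant det (h - t) * det (h + t) = det (h - t)^2.  Telescoping the
   recurrence, h - t = M_N(a) U with U upper unitriangular.

   Equality of distributions is tested on Fourier coefficients, since the
   trigonometric polynomials are dense in C^oo: a uniform approximation of the
   k-th derivative is integrated k times. *)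

(** * Smooth functions on open sets of the line *)

Section SmoothOn.
Context {R : realType}.
Implicit Types (U : set R) (f g : R -> R).

(** The relation [(1 - t) c = (1 + t) a] is blind to multiples of the Dirac mass at 1, whose Fourier
    coefficients are all equal. The recurrence therefore cannot give oddness alone, and [c_0] has to
    be computed from the definition of the product. Reflection, sigma and the product are picked by
    choice among the distributions with a prescribed property, so nothing can be computed with them
    before a witness is built. Continuity of a witness comes from seminorm estimates, localisation
    from partitions of unity made out of [exp(-1/x)]. The witness for sigma sends [f] to the mean of
    [sfun * (f - f 1)]: the subtraction keeps the integrand bounded, and nothing has to be added
    back because [sfun] is odd. Smooth parts carry junk values on their exceptional set. They are
    therefore compared only off that set, and become test functions after multiplication by a cutoff
    vanishing near it. *)

Definition smooth_on U f := forall n x, U x -> derivable f^`(n) x 1.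

Lemma derivable_eq_open U f g x : open U -> U x -> {in U, f =1 g} ->
  derivable f x 1 -> derivable g x 1.
Proof.
move=> oU Ux fg; apply: near_eq_derivable.
by near=> y; apply: fg; rewrite inE; near: y; exact: open_nbhs_nbhs.
Unshelve. all: by end_near. Qed.

Lemma derive1_eq_open U f g : open U -> {in U, f =1 g} ->
  {in U, f^`() =1 g^`()}.
Proof.
move=> oU fg x; rewrite inE => Ux; rewrite !derive1E; apply: near_eq_derive.
by near=> y; apply: fg; rewrite inE; near: y; exact: open_nbhs_nbhs.
Unshelve. all: by end_near. Qed.

(* A family of functions closed under differentiation on U consists of smooth
   functions: iterated derivatives never leave the family. *)
Lemma smooth_on_coind U (P : (R -> R) -> Prop) : open U ->
  (forall f, P f -> (forall x, U x -> derivable f x 1) /\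
    exists2 g, P g & {in U, f^`() =1 g}) ->
  forall f, P f -> smooth_on U f.
Proof.
move=> oU HP f Pf.
have H n : exists2 g, P g & {in U, f^`(n) =1 g}.
  elim: n => [|n [g Pg fg]]; first by exists f.
  have [_ [h Ph gh]] := HP _ Pg; exists h => // x xU.
  by rewrite derive1nS (derive1_eq_open oU fg) // gh.
move=> n x Ux; have [g Pg fg] := H n; have [dg _] := HP _ Pg.
apply: (derivable_eq_open oU Ux _ (dg x Ux)) => y yU.
by rewrite fg.
Qed.

Lemma smooth_on_derivable U f x : smooth_on U f -> U x -> derivable f x 1.
Proof. by move=> H; exact: (H 0%N). Qed.

Lemma smooth_on_derive1 U f : smooth_on U f -> smooth_on U f^`().
Proof. by move=> H n x Ux; rewrite -derive1Sn; exact: H. Qed.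

Lemma smooth_on_eq U f g : open U -> {in U, f =1 g} -> smooth_on U f ->
  smooth_on U g.
Proof.
move=> oU fg sf; apply: (smooth_on_coind oU
    (P := fun h => exists2 k, smooth_on U k & {in U, k =1 h})).
  move=> h [k sk kh]; split=> [x Ux|].
    by apply: (derivable_eq_open oU Ux kh); exact: smooth_on_derivable sk Ux.
  exists h^`() => //; exists k^`(); first exact: smooth_on_derive1.
  exact: derive1_eq_open.
by exists f.
Qed.

(** The derivative of each constructor is again expressed by the constructors, so coinduction gives
    smoothness of sums, products, inverses and compositions at once, without Leibniz or Faa di Bruno
    formulas. *)
Inductive smooth_closure U : (R -> R) -> Prop :=
| sc_base f : smooth_on U f -> smooth_closure U f
| sc_add f g : smooth_closure U f -> smooth_closure U g ->
    smooth_closure U (fun x => f x + g x)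
| sc_mul f g : smooth_closure U f -> smooth_closure U g ->
    smooth_closure U (fun x => f x * g x)
| sc_inv f : smooth_closure U f -> (forall x, U x -> f x != 0) ->
    smooth_closure U (fun x => (f x)^-1)
| sc_comp f g : smoothr f -> smooth_closure U g ->
    smooth_closure U (fun x => f (g x)).

Lemma smoothrE f : smoothr f <-> smooth_on setT f.
Proof. by split=> [H n x _|H n x]; exact: H. Qed.

Lemma smoothr_on U f : smoothr f -> smooth_on U f.
Proof. by move=> H n x _; exact: H. Qed.

Lemma smooth_closureP U f : open U -> smooth_closure U f -> smooth_on U f.
Proof.
move=> oU; apply: smooth_on_coind => // {}f; elim=> {f}.
- move=> f sf; split=> [x|]; first exact: smooth_on_derivable.
  by exists f^`() => //; apply: sc_base; exact: smooth_on_derive1.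
- move=> f g sf [df [f' sf' ff']] sg [dg [g' sg' gg']].
  split=> [x Ux|]; first exact: derivableD (df x Ux) (dg x Ux).
  exists (fun x => f' x + g' x); first exact: sc_add.
  move=> x xU; have Ux : U x by rewrite inE in xU.
  rewrite -ff' // -gg' // !derive1E.
  by rewrite -[fun y => _]/(f \+ g) deriveD //; [exact: df|exact: dg].
- move=> f g sf [df [f' sf' ff']] sg [dg [g' sg' gg']].
  split=> [x Ux|]; first exact: derivableM (df x Ux) (dg x Ux).
  exists (fun x => f x * g' x + g x * f' x).
    by apply: sc_add; exact: sc_mul.
  move=> x xU; have Ux : U x by rewrite inE in xU.
  rewrite -ff' // -gg' // !derive1E.
  by rewrite -[fun y => _]/(f \* g) deriveM //; [exact: df|exact: dg].
- move=> f sf [df [f' sf' ff']] f0.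
  split=> [x Ux|]; first exact: derivableV (f0 x Ux) (df x Ux).
  exists (fun x => -1 * ((f x)^-1 * ((f x)^-1 * f' x))).
    apply: sc_mul; first by apply: sc_base; exact/smoothr_on/smoothr_cst.
    by apply: sc_mul; [exact: sc_inv|apply: sc_mul => //; exact: sc_inv].
  move=> x xU; have Ux : U x by rewrite inE in xU.
  rewrite -ff' // !derive1E deriveV //; [|exact: f0|exact: df].
  by rewrite mulN1r mulrA -[LHS]/(- (f x ^- 2) * _) mulNr -invfM.
- move=> f g sf sg [dg [g' sg' gg']].
  have df y : derivable f y 1 by exact: (sf 0%N).
  split=> [x Ux|].
    apply/derivable1_diffP; apply: (@differentiable_comp _ _ _ _ g f).
      by apply/derivable1_diffP; exact: dg.
    exact/derivable1_diffP.
  exists (fun x => derive1 f (g x) * g' x).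
    by apply: sc_mul => //; apply: sc_comp => // n x; rewrite -derive1Sn.
  move=> x xU; have Ux : U x by rewrite inE in xU.
  rewrite -gg' // -[fun y => _]/(f \o g) derive1_comp //; exact: dg.
Qed.

Lemma smooth_onD U f g : open U -> smooth_on U f -> smooth_on U g ->
  smooth_on U (fun x => f x + g x).
Proof.
by move=> oU sf sg; apply: smooth_closureP => //; apply: sc_add; exact: sc_base.
Qed.

Lemma smooth_onM U f g : open U -> smooth_on U f -> smooth_on U g ->
  smooth_on U (fun x => f x * g x).
Proof.
by move=> oU sf sg; apply: smooth_closureP => //; apply: sc_mul; exact: sc_base.
Qed.

Lemma smooth_onN U f : open U -> smooth_on U f -> smooth_on U (fun x => - f x).
Proof.
move=> oU sf; have -> : (fun x => - f x) = (fun x => (fun=> -1) x * f x).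
  by apply/funext => x; rewrite mulN1r.
by apply: smooth_onM => //; exact/smoothr_on/smoothr_cst.
Qed.

Lemma smooth_onV U f : open U -> smooth_on U f -> (forall x, U x -> f x != 0) ->
  smooth_on U (fun x => (f x)^-1).
Proof.
by move=> oU sf f0; apply: smooth_closureP => //; apply: sc_inv => //;
  exact: sc_base.
Qed.

Lemma smoothr_comp f g : smoothr f -> smoothr g -> smoothr (f \o g).
Proof.
move=> sf sg; apply/smoothrE/smooth_closureP; first exact: openT.
by apply: sc_comp => //; exact/sc_base/smoothrE.
Qed.

Lemma smoothrV f : smoothr f -> (forall x, f x != 0) ->
  smoothr (fun x => (f x)^-1).
Proof.
by move=> /smoothrE sf f0; apply/smoothrE/smooth_onV => //; exact: openT.
Qed.

Lemma smoothr_id : smoothr (@id R).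
Proof.
move=> [|n] x; first exact: derivable_id.
rewrite derive1Sn; have -> : (@id R)^`() = fun=> 1.
  by apply/funext => y; rewrite derive1_id.
exact: smoothr_cst.
Qed.

End SmoothOn.

(** * A flat function *)

Section Bump.
Context {R : realType}.

(** Carrying the polynomial factor [p] makes the family stable under differentiation, [p] becoming
    [X^2 (p - p')]; smoothness of [exp(-1/x)] then follows by coinduction. *)
Definition flat_poly (p : {poly R}) (x : R) : R :=
  if 0 < x then p.[x^-1] * expR (- x^-1) else 0.

Definition flat (x : R) : R := flat_poly 1 x.

Lemma flat_gt0 x : 0 < x -> 0 < flat x.
Proof. by move=> x0; rewrite /flat /flat_poly x0 hornerE mul1r expR_gt0. Qed.

Lemma flat_eq0 x : x <= 0 -> flat x = 0.
Proof. by move=> x0; rewrite /flat /flat_poly ltNge x0. Qed.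

Lemma flat_ge0 x : 0 <= flat x.
Proof.
by have [x0|x0] := ltP 0 x; [exact/ltW/flat_gt0|rewrite flat_eq0].
Qed.

(** The exponential series gives [y^i <= i! e^y] for each monomial; the constant is a generous sum
    of these bounds. *)
Lemma poly_expRN_bounded (p : {poly R}) :
  exists2 C, 0 <= C & forall y, 0 < y -> `|p.[y] * expR (- y)| <= C.
Proof.
exists (\sum_(i < size p) `|p`_i| * i.+1`!%:R * 2).
  by apply: sumr_ge0 => i _; rewrite !mulr_ge0.
move=> y y0; rewrite horner_coef mulr_suml.
apply: le_trans (ler_norm_sum _ _ _) _; apply: ler_sum => i _.
rewrite -mulrA normrM -mulrA; apply: ler_wpM2l => //.
rewrite ger0_norm; last by rewrite mulr_ge0 ?expR_ge0 // exprn_ge0 // ltW.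
rewrite expRN ler_pdivrMr ?expR_gt0 //.
have F n : (0 : R) < n`!%:R by rewrite ltr0n fact_gt0.
case: (nat_of_ord i) => [|n].
  by rewrite expr0 (_ : 1`! = 1)%N // mul1r; have := expR_ge1Dx y; lra.
have H := expR_ge1Dxn n (ltW y0).
have : y ^+ n.+1 <= n.+1`!%:R * expR y.
  rewrite mulrC -ler_pdivrMr ?F //; apply: le_trans H; lra.
move/le_trans; apply; rewrite -mulrA; apply: ler_pM => //.
- by rewrite ler_nat [leqRHS]factS leq_pmull.
- by rewrite ler_peMl ?expR_ge0 //; lra.
Qed.

Lemma derive_flat_poly (p : {poly R}) (x : R) :
  is_derive x (1 : R) (flat_poly p) (flat_poly ('X ^+ 2 * (p - p^`())) x).
Proof.
have [x0|x0|->] := ltgtP x 0.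
- apply: (@near_eq_is_derive _ _ _ (cst 0)).
    near=> y; rewrite /flat_poly ifF //; apply/negbTE; rewrite -leNgt ltW //.
    by near: y; exact: lt_nbhsl.
  by rewrite /flat_poly ltNge ltW //=; exact: is_derive_cst.
- apply: (@near_eq_is_derive _ _ _ (fun y : R^o =>
    p.[y^-1] * expR (- y^-1) : R^o)).
    near=> y; rewrite /flat_poly ifT //.
    by near: y; exact: lt_nbhsr.
  have xn0 : x != 0 by rewrite gt_eqF.
  have dV : is_derive x 1 (fun y : R => y^-1) (- x ^- 2).
    split; first exact: derivableV.
    by rewrite (deriveV (f := id)) // derive_id scaler1.
  have dp : is_derive (x^-1) 1 (horner p) (p^`()).[x^-1].
    split; first exact: derivable_horner.
    by rewrite -derive1E -derivE.
  have d1 := is_derive1_comp dp dV.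
  have d2 := is_derive1_comp (is_derive_expR _) (is_deriveN dV).
  have d3 := is_deriveM d1 d2.
  refine (is_derive_eq d3 _).
  rewrite /flat_poly x0 /= !hornerE -![_ *: _]/(_ * _) /=; field.
  by rewrite xn0.
rewrite {2}/flat_poly ltxx.
(* At 0, writing [1/h = h * (1/h)^2] turns the difference quotient into [h] times a bounded
   quantity. *)
have [C C0 HC] := poly_expRN_bounded ('X^2 * p).
have key : h^-1 *: (flat_poly p (h *: (1 :
  R) + 0) - flat_poly p 0) @[h --> 0^'] --> (0 : R).
  apply/cvgrPdist_le => e e0; near=> h.
  rewrite sub0r normrN addr0 /flat_poly ltxx subr0 -![_ *: _]/(_ * _) mulr1.
  case: ifPn => h0; last by rewrite mulr0 normr0 ltW.
  have -> : h^-1 * (p.[h^-1] * expR (- h^-1)) =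
      h * (('X^2 * p).[h^-1] * expR (- h^-1)).
    by rewrite hornerM hornerXn expr2 !mulrA mulfV ?mul1r // gt_eqF.
  rewrite normrM (@le_trans _ _ (`|h| * C)) //.
    by rewrite ler_wpM2l // HC // invr_gt0.
  rewrite (@le_trans _ _ (`|h| * (C + 1))) ?ler_wpM2l //; first by lra.
  rewrite -ler_pdivlMr; last by lra.
  near: h; apply: dnbhs0_le; rewrite divr_gt0 //; lra.
split; first by apply/cvg_ex; exists 0.
exact: cvg_lim key.
Unshelve. all: by end_near. Qed.

Lemma smoothr_flat : smoothr flat.
Proof.
apply/smoothrE; apply: (smooth_on_coind openT
    (P := fun f => exists p, f = flat_poly p)); last by exists 1.
move=> _ [p ->]; split=> [x _|].
  by have [] := derive_flat_poly p x.
exists (flat_poly ('X ^+ 2 * (p - p^`()))); first by eexists.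
by move=> x _; rewrite derive1E; have [] := derive_flat_poly p x.
Qed.

End Bump.

(** * Estimates for periodic functions *)

Section RealEstimates.
Context {R : realType}.
Implicit Types f g : R -> R.

Lemma smoothr_is_derive f (x : R) : smoothr f -> is_derive x (1 :
  R) f (derive1 f x).
Proof. by move=> sf; rewrite derive1E; apply: derivableP; exact: (sf 0%N). Qed.

Lemma smoothr_continuous f : smoothr f -> continuous f.
Proof.
move=> sf x; apply/differentiable_continuous/derivable1_diffP; exact: (sf 0%N).
Qed.

Lemma smoothr_derive1 f : smoothr f -> smoothr (derive1 f).
Proof. by move=> sf n x; rewrite -derive1Sn. Qed.

Lemma derive1D_smooth f g : smoothr f -> smoothr g ->
  derive1 (fun x => f x + g x) = fun x => derive1 f x + derive1 g x.
Proof.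
move=> sf sg; apply/funext => x; rewrite !derive1E.
by rewrite -[fun y => _]/(f \+ g) deriveD //; [exact: (sf 0%N)|exact: (sg 0%N)].
Qed.

Lemma derive1M_smooth f g : smoothr f -> smoothr g ->
  derive1 (fun x => f x * g x) = fun x => f x * derive1 g x + g x * derive1 f x.
Proof.
move=> sf sg; apply/funext => x; rewrite !derive1E.
by rewrite -[fun y => _]/(f \* g) deriveM //; [exact: (sf 0%N)|exact: (sg 0%N)].
Qed.

Lemma derive1nD_smooth f g n : smoothr f -> smoothr g ->
  derive1n n (fun x => f x + g x) = fun x =>
    (derive1n n f) x + (derive1n n g) x.
Proof.
elim: n f g => [//|n IH] f g sf sg; rewrite !derive1Sn derive1D_smooth //.
exact: (IH _ _ (smoothr_derive1 sf) (smoothr_derive1 sg)).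
Qed.

Lemma derive1n_scale c f n : smoothr f ->
  derive1n n (fun x => c * f x) = fun x => c * (derive1n n f) x.
Proof.
elim: n f => [//|n IH] f sf.
rewrite !derive1Sn (derive1M_smooth (@smoothr_cst R c) sf).
rewrite -(IH _ (smoothr_derive1 sf)).
by congr (derive1n n _); apply/funext => x; rewrite derive1_cst mulr0 addr0.
Qed.

Lemma derive1n_opparg f n : smoothr f ->
  derive1n n (fun x => f (- x)) = fun x => (-1) ^+ n * (derive1n n f) (- x).
Proof.
elim: n f => [|n IH] f sf; first by apply/funext => x; rewrite expr0 mul1r.
rewrite !derive1Sn.
have -> : derive1 (fun x => f (- x)) = fun x => -1 * derive1 f (- x).
  apply/funext => x; rewrite derive1E mulN1r -mulrN1.
  have d := is_derive1_comp (smoothr_is_derive (- x) sf) (is_deriveNid x (1 :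
    R)).
  exact: (@derive_val _ _ _ _ _ _ _ d).
have sf' := smoothr_derive1 sf.
rewrite derive1n_scale; last first.
  apply: (smoothr_comp (g := -%R) sf').
  rewrite -[-%R]/(fun x : R => - x); apply: smoothrN; exact: smoothr_id.
rewrite IH //; apply/funext => x.
by rewrite mulrA exprS.
Qed.

(** The [C^n] norm, encoded as an upper bound so that no supremum has to exist. *)
Definition small n (d : R) f :=
  forall k x, (k <= n)%N -> `|(derive1n k f) x| <= d.

Lemma smallS n d f : (forall x, `|f x| <= d) -> small n d (derive1 f) ->
  small n.+1 d f.
Proof. by move=> f0 f1 [|k] x kn; [exact: f0|rewrite derive1Sn; exact: f1]. Qed.

Lemma small_derive1 n d f : small n.+1 d f -> small n d (derive1 f).
Proof. by move=> H k x kn; rewrite -derive1Sn; exact: H. Qed.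

Lemma smallW n m d e f : (m <= n)%N -> d <= e -> small n d f -> small m e f.
Proof.
by move=> mn de H k x km; apply: le_trans de; apply: H; apply: leq_trans mn.
Qed.

Lemma smallD n d e f g : smoothr f -> smoothr g ->
  small n d f -> small n e g -> small n (d + e) (fun x => f x + g x).
Proof.
move=> sf sg Hf Hg k x kn; rewrite derive1nD_smooth //.
by rewrite (le_trans (ler_normD _ _)) // lerD // ?Hf ?Hg.
Qed.

Lemma smallN n d f : smoothr f -> small n d f -> small n d (fun x => - f x).
Proof.
move=> sf H k x kn; have -> : (fun x => - f x) = (fun x => -1 * f x).
  by apply/funext => y; rewrite mulN1r.
by rewrite derive1n_scale // mulN1r normrN H.
Qed.

Lemma small_cst n d (c : R) : `|c| <= d -> small n d (fun=> c).
Proof.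
move=> cd [|k] x _; first by [].
have -> : derive1n k.+1 (fun=> c) x = 0; last by rewrite normr0 (le_trans _ cd).
rewrite derive1Sn; have -> : derive1 (fun=> c : R) = fun=> 0 * 1.
  by apply/funext => y; rewrite derive1_cst mul0r.
rewrite derive1n_scale ?mul0r //; exact: smoothr_cst.
Qed.

Definition bounded_derivatives g :=
  forall k, exists B : R, forall x, `|(derive1n k g) x| <= B.

Lemma bounded_derivatives1 g : bounded_derivatives g ->
  bounded_derivatives (derive1 g).
Proof. by move=> H k; have [B HB] := H k.+1; exists B => x;
  rewrite -derive1Sn. Qed.

(** Multiplication by [g] is bounded for the [C^n] norm: by induction on [n], the product rule
    reduces order [n + 1] for [g] to order [n] for [g] and for [g']. *)
Lemma smallM n g : smoothr g -> bounded_derivatives g ->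
  exists2 C, 0 <= C & forall f d, smoothr f -> small n d f ->
    small n (C * d) (fun x => g x * f x).
Proof.
elim: n g => [|n IH] g sg bg.
  have [B HB] := bg 0%N; exists B; first exact: le_trans (HB 0).
  by move=> f d sf Hf [|//] x _; rewrite normrM ler_pM //; exact: (Hf 0%N).
have [C0 C00 H0] := IH _ sg bg.
have [C1 C10 H1] := IH _ (smoothr_derive1 sg) (bounded_derivatives1 bg).
have [B HB] := bg 0%N; have B0 : 0 <= B by exact: le_trans (HB 0).
exists (B + (C0 + C1)); first by rewrite !addr_ge0.
move=> f d sf Hf; have d0 : 0 <= d by exact: le_trans (Hf 0%N 0 isT).
apply: smallS => [x|].
  rewrite normrM (@le_trans _ _ (B * d)) //.
    by rewrite ler_pM // ?HB //; exact: (Hf 0%N).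
  by rewrite ler_wpM2r // lerDl addr_ge0.
rewrite derive1M_smooth //.
have sf' := smoothr_derive1 sf; have sg' := smoothr_derive1 sg.
apply: (@smallW n n (C0 * d + C1 * d)) => //.
  by rewrite -mulrDl ler_wpM2r // lerDr.
apply: smallD; [exact: smoothrM|exact: smoothrM| |].
  by apply: H0 => //; exact: small_derive1.
under eq_fun do rewrite mulrC.
apply: H1 => //; exact: smallW Hf.
Qed.

Lemma MVT_bound f B (x y : R) : smoothr f -> (forall z, `|derive1 f z| <= B) ->
  `|f x - f y| <= B * `|x - y|.
Proof.
move=> sf HB; wlog xy : x y / y <= x.
  move=> H; have [/H//|/ltW/H] := leP y x.
  by rewrite distrC (distrC y).
have [z _ ->] := MVT_segment xy (fun z _ => smoothr_is_derive z sf)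
  (continuous_subspaceT (smoothr_continuous sf)).
by rewrite normrM ler_wpM2r.
Qed.

(** The mean value theorem gives [sin (y/2) >= (y/2) cos (y/2)], hence [sin y = 2 sin (y/2) cos
    (y/2) >= y cos^2 (y/2) = y (1 + cos y) / 2], where [cos y >= 0]. *)
Lemma sin_ge_half (y : R) : 0 <= y <= pi / 2 -> y / 2 <= sin y.
Proof.
move=> /andP[y0 y1]; have pi2 := @pi_ge2 R.
have [c] := MVT_segment (f := sin) (df := cos) (a := 0) (b := y / 2)
   (ltac:(lra)) (fun z _ => is_derive_sin z) (continuous_subspaceT
     (@continuous_sin R)).
rewrite in_itv /= sin0 !subr0 => /andP[c0 c1] E.
have Hc : cos (y / 2) <= cos c.
  have [->//|cy] := eqVneq c (y / 2).
  apply: ltW; rewrite ltr_cos ?in_itv /=; [|lra..].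
  by rewrite lt_neqAle cy.
have cy0 : 0 <= cos (y / 2) by apply: cos_ge0_pihalf; lra.
have cy1 : 0 <= cos y by apply: cos_ge0_pihalf; lra.
have yE : y = (y / 2) *+ 2 by rewrite mulr2n; field.
have sE : sin y = 2 * (cos (y / 2) * sin (y / 2)).
  by rewrite {1}yE sin_mulr2n mulr2n; ring.
have cE : cos y = 2 * cos (y / 2) ^+ 2 - 1.
  by rewrite {1}yE cos_mulr2n mulr2n; ring.
have H : cos (y / 2) * (y / 2) <= sin (y / 2).
  by rewrite E ler_wpM2r //; lra.
rewrite sE; have : cos (y / 2) * (cos (y / 2) * (y / 2)) <= cos (y / 2) * sin
  (y / 2).
  by rewrite ler_wpM2l.
nra.
Qed.

Lemma periodicz f (T : R) : periodic f T -> forall (k :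
  int) a, f (a + T *~ k) = f a.
Proof.
move=> pf [n|n] a; first by rewrite -pmulrn periodicn.
by rewrite NegzE mulrNz -pmulrn -[in RHS](subrK (T *+ n.+1) a) [RHS]periodicn.
Qed.

Lemma periodic_reduce (T : R) : 0 < T -> forall x, exists k : int, exists2 y :
  R,
  0 <= y < T & x = y + T *~ k.
Proof.
move=> T0 x; have /andP[k0 k1] := floor_itv (x / T).
exists (Num.floor (x / T)); exists (x - T *~ Num.floor (x / T));
  last by rewrite subrK.
have k1' : x < ((Num.floor (x / T))%:~R + 1) * T.
  by rewrite -ltr_pdivrMr // -[1]/(1%:~R) -intrD.
by rewrite ler_pdivlMr // in k0; rewrite -mulrzr; lra.
Qed.

Lemma periodic_bounded f (T : R) : 0 < T -> periodic f T -> smoothr f ->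
  exists B : R, forall x, `|f x| <= B.
Proof.
move=> T0 pf sf; have cf : continuous (fun x => `|f x|).
  by move=> x; apply: cvg_norm; exact: smoothr_continuous.
have [c _ Hc] := EVT_max (ltW T0) (continuous_subspaceT cf).
exists `|f c| => x; have [k [y /andP[y0 y1] ->]] := periodic_reduce T0 x.
by rewrite periodicz // Hc // in_itv /= y0 ltW.
Qed.

Lemma periodic_derive1 f (T : R) : periodic f T -> smoothr f ->
  periodic (derive1 f) T.
Proof.
move=> pf sf x; rewrite /derive1.
suff -> : (fun h : R => h^-1 *: (f (h + (x + T)) - f (x + T))) =
  (fun h => h^-1 *: (f (h + x) - f x)) by [].
by apply/funext => h; rewrite addrA !pf.
Qed.

Lemma periodic_bounded_derivatives f (T : R) : 0 < T -> periodic f T ->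
  smoothr f -> bounded_derivatives f.
Proof.
move=> T0 pf sf k.
have [pk sk] : periodic (derive1n k f) T /\ smoothr (derive1n k f).
  elim: k => [|k [IH1 IH2]]; first by [].
  by rewrite derive1nS; split; [exact: periodic_derive1|exact: smoothr_derive1].
exact: periodic_bounded pk sk.
Qed.

(** A periodic function is Lipschitz for the chordal distance, since an arc [d <= pi] satisfies
    [d <= 4 sin (d/2)]. *)
Lemma periodic_chord f B (x y : R) : periodic f (pi *+ 2) -> smoothr f ->
  (forall z, `|derive1 f z| <= B) ->
  `|f x - f y| <= 4 * B * `|sin ((x - y) / 2)|.
Proof.
move=> pf sf HB; have B0 : 0 <= B by exact: le_trans (HB 0).
have pi0 := @pi_gt0 R; have T0 : (0 : R) < pi *+ 2 by rewrite mulr2n; lra.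
have [k [d /andP[d0 d1] dE]] := periodic_reduce T0 (x - y).
have -> : f x = f (y + d).
  by rewrite -[RHS](periodicz pf k) -addrA -dE addrC subrK.
have -> : `|sin ((x - y) / 2)| = sin (d / 2).
  have -> : (x - y) / 2 = d / 2 + pi *~ k.
    by rewrite dE -[pi *~ k]mulrzr -[pi *+ 2 *~ k]mulrzr mulr2n; field.
  have Hs n : `|sin (d / 2 + pi *+ n)| = `|sin (d / 2)|.
    by rewrite (alternatingn (@sinDpi R)) normrM normrX normrN1 expr1n mul1r.
  have sd : 0 <= sin (d / 2).
    by apply: sin_ge0_pi; rewrite mulr2n in d1; lra.
  case: k {dE} => n; first by rewrite -pmulrn Hs ger0_norm.
  rewrite NegzE mulrNz -pmulrn -[in RHS](subrK (pi *+ n.+1) (d / 2)).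
  rewrite (alternatingn (@sinDpi R)) -[RHS]ger0_norm ?normrM ?normrX ?normrN1
    ?expr1n ?mul1r //.
  by rewrite -(alternatingn (@sinDpi R)) subrK.
rewrite mulr2n in d1.
(* An arc longer than [pi] is replaced by its complement [2 pi - d], which has the same chord. *)
have [dpi|dpi] := leP d pi.
  have := MVT_bound (y + d) y sf HB; rewrite (addrC y) addrK (ger0_norm d0).
  move/le_trans; apply; rewrite -mulrA mulrCA ler_wpM2l //.
  by have := @sin_ge_half (d / 2) (ltac:(lra)); lra.
have -> : f (y + d) = f (y + (d - pi *+ 2)).
  by rewrite -[RHS]pf -addrA subrK.
have E : `|y + (d - pi *+ 2) - y| = pi *+ 2 - d.
  by rewrite addrAC subrr add0r ler0_norm ?opprB // mulr2n; lra.
have := MVT_bound (y + (d - pi *+ 2)) y sf HB; rewrite E mulr2n.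
move/le_trans; apply; rewrite -mulrA mulrCA ler_wpM2l //.
have := @sin_ge_half (pi - d / 2) (ltac:(lra)).
have -> : sin (pi - d / 2) = sin (d / 2).
  by rewrite addrC sinDpi sinN opprK.
by lra.
Qed.

End RealEstimates.

(** * The circle and its angle parametrization *)

Section CircleBasics.
Context {R : realType}.

Lemma circle_eqP (t u : circle R) : val t = val u -> t = u.
Proof. exact: val_inj. Qed.

Lemma circle_normE (t : circle R) : `|(val t : R[i])| = 1.
Proof. by have := valP t; rewrite inE. Qed.

Lemma circle_neq0 (t : circle R) : (val t : R[i]) != 0.
Proof. by rewrite -normr_eq0 circle_normE oner_eq0. Qed.

Lemma expi_periodic (x : R) : expi (x + pi *+ 2) = expi x.
Proof. by apply: circle_eqP; rewrite /= cosD2pi sinD2pi. Qed.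

Lemma expi0 : expi 0 = circle_one :> circle R.
Proof. by apply: circle_eqP; rewrite /= cos0 sin0. Qed.

Lemma expiD (x y : R) : (val (expi (x + y)) :
  R[i]) = val (expi x) * val (expi y).
Proof.
rewrite /= cosD sinD; apply/eqP; rewrite eq_complex /=.
by apply/andP; split; apply/eqP; ring.
Qed.

Lemma circle_inv_expi (x : R) : circle_inv (expi x) = expi (- x).
Proof.
apply: circle_eqP; rewrite [LHS]/=; apply: (mulfI (circle_neq0 (expi x))).
rewrite divff ?circle_neq0 // -[RHS]expiD subrr.
by rewrite expi0.
Qed.

Lemma circle_invK : involutive (@circle_inv R).
Proof. by move=> t; apply: circle_eqP; rewrite /= invrK. Qed.

Lemma expi_exprz (x : R) (n : int) : (val (expi x) :
  R[i]) ^ n = val (expi (x *~ n)).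
Proof.
have H (m : nat) y : (val (expi y) : R[i]) ^+ m = val (expi (y *+ m)).
  elim: m => [|m IH]; first by rewrite expr0 mulr0n expi0.
  by rewrite exprS IH mulrS expiD.
case: n => n; first by rewrite -exprnP H -pmulrn.
rewrite NegzE mulrNz -pmulrn -circle_inv_expi.
by rewrite -[RHS]/((val (expi (x *+ n.+1)) : R[i])^-1) -H exprnN.
Qed.

Lemma expi_surj (t : circle R) : exists2 x : R, 0 <= x <= pi *+ 2 & expi x = t.
Proof.
have := circle_normE t; case: t => -[a b] tP /= .
rewrite normc_def /= => -[] /eqP.
rewrite -(@eqrXn2 _ 2) ?sqrtr_ge0 // sqr_sqrtr ?addr_ge0 ?sqr_ge0 // expr1n =>
  /eqP ab.
have a1 : -1 <= a <= 1 by nra.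
have pi0 := @pi_gt0 R; have ac0 := acos_ge0 a1; have ac1 := acos_lepi a1.
have cosE : cos (acos a) = a by rewrite acosK // in_itv.
have sinE : sin (acos a) = `|b|.
  rewrite sin_acos // -sqrtr_sqr; congr Num.sqrt; lra.
have [b0|b0] := leP 0 b.
  exists (acos a); first by rewrite mulr2n; lra.
  by apply: circle_eqP; rewrite /= cosE sinE ger0_norm.
exists (- acos a + pi *+ 2); first by rewrite mulr2n; lra.
apply: circle_eqP; rewrite expi_periodic /= cosN sinN cosE sinE.
by rewrite ltr0_norm // opprK.
Qed.

Lemma normc_le (z : R[i]) (B : R) :
  `|complex.Re z| <= B -> `|complex.Im z| <= B ->
  `|z| <= (2 * B)%:C%C.
Proof.
move=> HR HI; have B0 : 0 <= B by exact: le_trans HR.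
rewrite normc_def lecR; apply: le_trans (_ : Num.sqrt ((2 * B) ^+ 2) <= _);
  last first.
  by rewrite sqrtr_sqr ger0_norm // mulr_ge0.
apply: ler_wsqrtr; move: HR HI; rewrite !ler_norml; nra.
Qed.

Lemma Re_le_normc (z : R[i]) (B : R) : `|z| <= B%:C%C -> `|complex.Re z| <= B.
Proof. by move=> H; have := le_trans (normc_ge_Re z) H; rewrite lecR. Qed.

Lemma Im_le_normc (z : R[i]) (B : R) : `|z| <= B%:C%C -> `|complex.Im z| <= B.
Proof.
move=> H; have E : complex.Im z = - complex.Re ('i%C * z).
  by case: z {H} => a b /=; rewrite mul0r mul1r sub0r opprK.
by rewrite E normrN; apply: Re_le_normc;
  rewrite normrM normc_def /= expr0n expr1n add0r sqrtr1 mul1r.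
Qed.

End CircleBasics.

(** * Continuity in terms of seminorms *)

Section TestSeminorms.
Context {R : realType}.
Implicit Types f g h : test_fun R.

Definition reA (f : circle R -> R[i]^o) (x : R) : R := complex.Re (f (expi x)).
Definition imA (f : circle R -> R[i]^o) (x : R) : R := complex.Im (f (expi x)).

Lemma smooth_off0P (f : circle R -> R[i]^o) :
  smooth_off set0 f <-> smoothr (reA f) /\ smoothr (imA f).
Proof.
split=> [H|[H1 H2] n x _]; last by split; [exact: H1|exact: H2].
by split=> n x; [exact: (H n x id).1|exact: (H n x id).2].
Qed.

Lemma reA_smooth f : smoothr (reA f).
Proof. by have /smooth_off0P[] := test_smooth f. Qed.

Lemma imA_smooth f : smoothr (imA f).
Proof. by have /smooth_off0P[] := test_smooth f. Qed.

Lemma reA_periodic f : periodic (reA f) (pi *+ 2).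
Proof. by move=> x; rewrite /reA expi_periodic. Qed.

Lemma imA_periodic f : periodic (imA f) (pi *+ 2).
Proof. by move=> x; rewrite /imA expi_periodic. Qed.

Lemma test_addE f g t : (f + g) t = f t + g t. Proof. by []. Qed.
Lemma test_oppE f t : (- f) t = - f t. Proof. by []. Qed.
Lemma test_subE f g t : (f - g) t = f t - g t. Proof. by []. Qed.
Lemma test_scaleE (c : R[i]) f t : (c *: f) t = c * f t. Proof. by []. Qed.
Lemma test_zeroE t : (0 : test_fun R) t = 0. Proof. by []. Qed.

Lemma test_eqP f g : f =1 g -> f = g.
Proof. by move=> fg; apply: val_inj; apply/funext. Qed.

Definition csmall n (d : R) (f : circle R -> R[i]^o) :=
  small n d (reA f) /\ small n d (imA f).

Lemma csmallW n m d e (f : circle R -> R[i]^o) :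
  (m <= n)%N -> d <= e -> csmall n d f -> csmall m e f.
Proof. by move=> mn de [H1 H2]; split; [exact: smallW H1|exact: smallW H2]. Qed.

Lemma reA_sub f g k x :
  derive1n k (reA (f - g)) x = derive1n k (reA f) x - derive1n k (reA g) x.
Proof.
have -> : reA (f - g) = fun x => reA f x + -1 * reA g x.
  by apply/funext => y; rewrite /reA test_subE [LHS]raddfB mulN1r.
rewrite derive1nD_smooth; last 2 first.
- exact: reA_smooth.
- by apply: smoothrM; [exact: smoothr_cst|exact: reA_smooth].
by rewrite derive1n_scale ?mulN1r //; exact: reA_smooth.
Qed.

Lemma imA_sub f g k x :
  derive1n k (imA (f - g)) x = derive1n k (imA f) x - derive1n k (imA g) x.
Proof.
have -> : imA (f - g) = fun x => imA f x + -1 * imA g x.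
  by apply/funext => y; rewrite /imA test_subE [LHS]raddfB mulN1r.
rewrite derive1nD_smooth; last 2 first.
- exact: imA_smooth.
- by apply: smoothrM; [exact: smoothr_cst|exact: imA_smooth].
by rewrite derive1n_scale ?mulN1r //; exact: imA_smooth.
Qed.

Lemma csmallZ n d (c : R) f : csmall n d f -> csmall n (`|c| * d) (c%:C%C *: f).
Proof.
move=> [H1 H2]; split=> k x kn.
- have -> : reA (c%:C%C *: f) = fun x => c * reA f x.
    by apply/funext => y; rewrite /reA test_scaleE; case: (f _) => a b /=;
      rewrite mul0r subr0.
  by rewrite derive1n_scale ?normrM ?ler_wpM2l ?H1 //; exact: reA_smooth.
- have -> : imA (c%:C%C *: f) = fun x => c * imA f x.
    by apply/funext => y; rewrite /imA test_scaleE; case: (f _) => a b /=;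
      rewrite mul0r addr0.
  by rewrite derive1n_scale ?normrM ?ler_wpM2l ?H2 //; exact: imA_smooth.
Qed.

Lemma test_deriv_sub k f g x :
  (test_deriv k g : R -> R[i]^o) x - (test_deriv k f : R -> R[i]^o) x =
  (derive1n k (reA (g - f)) x +i* derive1n k (imA (g - f)) x)%C.
Proof. by rewrite reA_sub imA_sub. Qed.

(** With [nbhs_test_small], this translates the supremum of initial topologies into seminorm balls.
    Each single order of derivation gives a neighbourhood, and finitely many are intersected. *)
Lemma nbhs_csmall n d f : 0 < d -> nbhs f [set g :
  test_fun R | csmall n d (g - f)].
Proof.
move=> d0.
have H k : nbhs f [set g :
  test_fun R | forall x, `|derive1n k (reA (g - f)) x| <= d /\
    `|derive1n k (imA (g - f)) x| <= d].
  have /cvg_sup /(_ k) C : nbhs f --> (f : test_fun R) by exact: cvg_id.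
  apply: C.
  have dC : (0 : R[i]) < d%:C%C by rewrite ltcR.
  have U : nbhs (test_deriv k f) [set h : {uniform R -> R[i]^o} |
      forall x, ball (test_deriv k f x : R[i]^o) d%:C%C (h x : R[i]^o)].
    apply/uniform_nbhs; exists [set xy | ball xy.1 d%:C%C xy.2]; split.
      exact: (@entourage_ball _ (R[i]^o) (PosNum dC)).
    by move=> h Hh x; exact: Hh.
  have W : nbhs (f : initial_topology (@test_deriv R k))
    (@test_deriv R k @^-1` [set h : {uniform R -> R[i]^o} |
      forall x, ball (test_deriv k f x : R[i]^o) d%:C%C (h x : R[i]^o)]).
    exact: (@initial_continuous _ _ (@test_deriv R k) f _ U).
  refine (@filterS _ _ _ _ _ _ W) => g Hg x.
  have {Hg} := Hg x; rewrite /ball /= distrC [X in `|X| < _]test_deriv_sub =>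
    /ltW Hx.
  by split; [exact: (Re_le_normc Hx)|exact: (Im_le_normc Hx)].
elim: n => [|n IH].
  by apply: filterS (H 0%N) => g Hg; split=> -[|//] x _; have [] := Hg x.
apply: filterS (filterI IH (H n.+1)) => g [[IH1 IH2] Hg].
by split=> k x; rewrite leq_eqVlt => /predU1P[->|]; have [? ?] := Hg x => //;
  [exact: IH1|exact: IH2].
Qed.

(** The sets containing a seminorm ball around [f] form a filter. It converges to [f] in each of the
    initial topologies, hence in their supremum, so it contains every neighbourhood. *)
Lemma nbhs_test_small f (A : set (test_fun R)) : nbhs f A ->
  exists n, exists2 d, 0 < d & forall g, csmall n d (g - f) -> A g.
Proof.
pose F : set_system (test_fun R) := [set A : set (test_fun R) |
  exists n, exists2 d, 0 < d & forall g, csmall n d (g - f) -> A g].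
have FF : Filter F.
  split.
  - by exists 0%N; exists 1.
  - move=> P Q [n [d d0 HP]] [m [e e0 HQ]].
    exists (maxn n m); exists (Num.min d e); first by rewrite lt_min d0.
    move=> g Hg; split.
    + apply: HP; apply: csmallW Hg; first exact: leq_maxl.
      by rewrite ge_min lexx.
    + apply: HQ; apply: csmallW Hg; first exact: leq_maxr.
      by rewrite ge_min lexx orbT.
  - move=> P Q PQ [n [d d0 HP]]; exists n, d => // g Hg.
    by apply: PQ; exact: HP.
suff : F --> f by move=> FA /FA.
apply/cvg_sup => k B.
move=> [_ [[V oV <-] Vf VB]].
have : nbhs (test_deriv k f) V by exact: open_nbhs_nbhs.
move/uniform_nbhs => [E [+ EV]]; rewrite -entourage_from_ballE => -[e /= e0 eE].
have eR : e = (complex.Re e)%:C%C by apply/esym/ RRe_real; rewrite realE ltW.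
have e0' : 0 < complex.Re e by rewrite eR ltcR in e0.
(* A third suffices: passing from components to the modulus costs a factor 2. *)
exists k; exists (complex.Re e / 3); first by rewrite divr_gt0.
move=> g [Hg1 Hg2]; apply: VB; apply: EV => x _; apply: eE => /=.
rewrite /ball /= distrC [X in `|X| < _]test_deriv_sub eR.
have Hz := @normc_le R (derive1n k (reA (g - f)) x +i* derive1n k (imA (g - f))
  x)%C
  _ (Hg1 k x (leqnn k)) (Hg2 k x (leqnn k)).
apply: le_lt_trans Hz _.
by rewrite ltcR; lra.
Qed.

Definition dist_bounded (T : test_fun R -> R[i]) :=
  exists n, exists2 C : R, 0 <= C &
    forall d f, 0 < d -> csmall n d f -> `|T f| <= (C * d)%:C%C.

Definition op_bounded (L : test_fun R -> test_fun R) :=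
  forall n, exists m, exists2 C : R, 0 < C &
    forall d f, 0 < d -> csmall m d f -> csmall n (C * d) (L f).

Lemma dist_bounded_comp T L : dist_bounded T -> op_bounded L ->
  dist_bounded (T \o L).
Proof.
move=> [n [C C0 HT]] HL; have [m [D D0 HD]] := HL n.
exists m; exists (C * D); first by rewrite mulr_ge0 // ltW.
move=> d f d0 fd; rewrite -mulrA; apply: HT; first by rewrite mulr_gt0.
exact: HD.
Qed.

Lemma dist_bounded_add T S : dist_bounded T -> dist_bounded S ->
  dist_bounded (fun f => T f + S f).
Proof.
move=> [n [C C0 HT]] [m [D D0 HS]].
exists (maxn n m); exists (C + D); first by rewrite addr_ge0.
move=> d f d0 fd; rewrite mulrDl rmorphD.
apply: le_trans (ler_normD _ _) _; apply: lerD.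
- by apply: HT => //; apply: csmallW fd => //; exact: leq_maxl.
- by apply: HS => //; apply: csmallW fd => //; exact: leq_maxr.
Qed.

(** Continuity at 0 sends some seminorm ball of radius [d] into the unit ball; rescaling by [d / e]
    turns this into a homogeneous bound with constant [1 / d]. *)
Lemma dist_boundedP (a : circle_dist R) : dist_bounded a.
Proof.
have a00 : a 0 = 0 by exact: linear0.
have a0 : nbhs (a 0 : R[i]^o) [set z : R[i]^o | `|z| < 1].
  rewrite a00; have := @nbhsx_ballx _ (R[i]^o) 0 1 ltr01.
  by apply: filterS => z; rewrite /ball /= sub0r normrN.
have := @dist_continuous R a 0 _ a0.
move=> /nbhs_test_small[n [d d0 H]].
exists n; exists d^-1; first by rewrite invr_ge0 ltW.
move=> e f e0 fe.
have /H /ltW : csmall n d ((d / e)%:C%C *: f - 0).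
  rewrite subr0; apply: csmallW (csmallZ (d / e) fe) => //.
  by rewrite gtr0_norm ?divr_gt0 // divfK // gt_eqF.
rewrite linearZ /= normrM => H1.
have de : 0 < d / e by rewrite divr_gt0.
rewrite -(ler_pM2l (x := (d / e)%:C%C)) ?ltcR //.
have -> : (d / e)%:C%C * (d^-1 * e)%:C%C = 1.
  rewrite -rmorphM /= (_ : d / e * (d^-1 * e) = 1) //; field.
  by rewrite !gt_eqF.
have NE : `|(d / e)%:C%C :
  R[i]| = (d / e)%:C%C by rewrite ger0_norm // lecR ltW.
rewrite -[X in X * _]NE; exact: H1.
Qed.

(** The source of all witnesses: a seminorm bound on a linear functional gives its continuity,
    applied to the difference [g - f]. *)
Lemma dist_mk (T : test_fun R -> R[i]^o) : linear T -> dist_bounded T ->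
  exists c : circle_dist R, forall f, c f = T f.
Proof.
move=> lT [n [C C0 HT]].
pose mL := GRing.isLinear.Build _ _ _ _ T lT.
pose L : {linear test_fun R -> R[i]^o} := HB.pack T mL.
have cL : continuous L.
  move=> f A /nbhs_ballP[e /= e0 eA].
  have eR : e = (complex.Re e)%:C%C by apply/esym/RRe_real; rewrite realE ltW.
  have e0' : 0 < complex.Re e by rewrite eR ltcR in e0.
  have dpos : 0 < complex.Re e / (C + 1) by rewrite divr_gt0 //; lra.
  apply: filterS (nbhs_csmall n f dpos) => g Hg; apply: eA.
  have E : L g - L f = T (g - f) by rewrite -[T (g - f)]/(L (g - f)) raddfB.
  rewrite /ball /= distrC [X in `|X|]E eR;
    apply: le_lt_trans (HT _ _ dpos Hg) _.
  rewrite ltcR mulrA ltr_pdivrMr; last by lra.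
  by nra.
by exists (CircleDist cL).
Qed.

End TestSeminorms.

(** * Density of trigonometric polynomials *)

Section TrigPoly.
Context {R : realType}.
Implicit Types f g q : test_fun R.

Inductive trig : test_fun R -> Prop :=
| trig0 : trig 0
| trigZD c n f : trig f -> trig (c *: chi n + f).

Lemma trigD f g : trig f -> trig g -> trig (f + g).
Proof.
move=> tf tg; elim: tf => [|c n h _ IH]; first by rewrite add0r.
by rewrite -addrA; exact: trigZD.
Qed.

Lemma trigZ (c : R[i]) f : trig f -> trig (c *: f).
Proof.
elim=> [|d n h _ IH]; first by rewrite scaler0; exact: trig0.
by rewrite scalerDr scalerA; exact: trigZD.
Qed.

Lemma trig_chi n : trig (chi n).
Proof. by rewrite -[chi n]addr0 -[chi n]scale1r; exact: trigZD trig0. Qed.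

Lemma trig_sum (I : Type) (r : seq I) (F : I -> test_fun R) :
  (forall i, trig (F i)) -> trig (\sum_(i <- r) F i).
Proof.
move=> tF; elim: r => [|i r IH]; first by rewrite big_nil; exact: trig0.
by rewrite big_cons; exact: trigD.
Qed.

Lemma test_sumE (I : Type) (r : seq I) (F : I -> test_fun R) t :
  (\sum_(i <- r) F i) t = \sum_(i <- r) F i t.
Proof.
elim: r => [|i r IH]; first by rewrite !big_nil.
by rewrite !big_cons test_addE IH.
Qed.

Lemma reA_chi (c : R[i]) n x : reA (c *: chi n) x =
  complex.Re c * cos (n%:~R * x) - complex.Im c * sin (n%:~R * x).
Proof.
rewrite /reA test_scaleE /chi [X in _ * X](expi_exprz x n) mulrzl.
by case: c.
Qed.

Lemma imA_chi (c : R[i]) n x : imA (c *: chi n) x =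
  complex.Re c * sin (n%:~R * x) + complex.Im c * cos (n%:~R * x).
Proof.
rewrite /imA test_scaleE /chi [X in _ * X](expi_exprz x n) mulrzl.
by case: c.
Qed.

Lemma is_derive_trig (a b m x : R) :
  is_derive x (1 : R) (fun x => a * cos (m * x) + b * sin (m * x))
    (m * (b * cos (m * x) - a * sin (m * x))).
Proof.
have dm : is_derive x (1 : R) (fun x : R => m * x) m.
  have := @is_deriveZ R R^o R^o id m x 1 1 (is_derive_id x 1).
  by rewrite -[X in is_derive _ _ _ X]/(m * 1) mulr1.
have dc := is_derive1_comp (is_derive_cos (m * x)) dm.
have ds := is_derive1_comp (is_derive_sin (m * x)) dm.
have d1 := @is_deriveZ R R^o R^o _ a x 1 _ dc.
have d2 := @is_deriveZ R R^o R^o _ b x 1 _ ds.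
have d := is_deriveD d1 d2.
refine (is_derive_eq d _).
by rewrite -![_ *: _]/(_ * _); ring.
Qed.

(** The constant term [p] of [q] has no periodic antiderivative, so it is split off; every other
    character integrates to a multiple of itself. *)
Lemma trig_antiderivative q : trig q -> exists Q, exists2 p : R[i], trig Q &
  forall x : R, is_derive x (1 : R) (reA Q) (reA q x - complex.Re p) /\
    is_derive x (1 : R) (imA Q) (imA q x - complex.Im p).
Proof.
have reD f g : reA (f + g) = fun x => reA f x + reA g x.
  by apply/funext => x; rewrite /reA test_addE [LHS]raddfD.
have imD f g : imA (f + g) = fun x => imA f x + imA g x.
  by apply/funext => x; rewrite /imA test_addE [LHS]raddfD.
elim=> [|c n f _ [Q [p tQ HQ]]].
  exists 0, 0; first exact: trig0.
  have -> : reA (0 : test_fun R) = cst 0 by apply/funext.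
  have -> : imA (0 : test_fun R) = cst 0 by apply/funext.
  by move=> x; rewrite /= subr0; split; exact: is_derive_cst.
have [->|n0] := eqVneq n 0.
  exists Q, (p + c) => // x; have [H1 H2] := HQ x.
  rewrite reD imD reA_chi imA_chi mul0r cos0 sin0 !mulr1 !mulr0 add0r subr0.
  split.
  - by refine (is_derive_eq H1 _); case: (p) (c) => ? ? [? ?] /=; ring.
  - by refine (is_derive_eq H2 _); case: (p) (c) => ? ? [? ?] /=; ring.
have nR0 : (n%:~R : R) != 0 by rewrite intr_eq0.
(* This is [c / (i n)]. *)
pose d := (complex.Im c / n%:~R +i* - (complex.Re c / n%:~R))%C.
exists (d *: chi n + Q), p; first exact: trigZD.
move=> x; have [H1 H2] := HQ x; rewrite !reD !imD; split.
- have -> : reA (d *: chi n) = fun x =>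
    (complex.Im c / n%:~R) * cos (n%:~R * x) +
      (complex.Re c / n%:~R) * sin (n%:~R * x).
    by apply/funext => y; rewrite reA_chi /d /=; ring.
  refine (is_derive_eq (is_deriveD (is_derive_trig _ _ _ x) H1) _).
  by rewrite reA_chi; field.
- have -> : imA (d *: chi n) = fun x =>
    (- (complex.Re c / n%:~R)) * cos (n%:~R * x) +
      (complex.Im c / n%:~R) * sin (n%:~R * x).
    by apply/funext => y; rewrite imA_chi /d /=; ring.
  refine (is_derive_eq (is_deriveD (is_derive_trig _ _ _ x) H2) _).
  by rewrite imA_chi; field.
Qed.

Lemma pi_lt4 : (pi : R) < 4.
Proof. by have := @pihalf_lt2 R; lra. Qed.

(* The constant term p of q is small because F' has mean zero. *)
Lemma antiderivative_small n (e : R) (F Q q : R -> R) (p : R) :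
  smoothr F -> smoothr Q -> smoothr q ->
  periodic F (pi *+ 2) -> periodic Q (pi *+ 2) ->
  (forall x : R, is_derive x (1 : R) Q (q x - p)) ->
  small n e (fun x => derive1 F x - q x) ->
  small n.+1 (16 * e) (fun x => F x - (Q x + (F 0 - Q 0))).
Proof.
move=> sF sQ sq pF pQ dQ He.
have e0 : 0 <= e by exact: le_trans (He 0%N 0 isT).
have pi0 := @pi_gt0 R; have pi4 := pi_lt4.
have T0 : (0 : R) < pi *+ 2 by rewrite mulr2n; lra.
have QE : derive1 Q = fun x => q x - p.
  by apply/funext => x; rewrite derive1E; exact: derive_val.
have sH c : smoothr (fun x => F x - Q x + c * x).
  have sc : smoothr (fun x => c * x) :=
    smoothrM (@smoothr_cst R c) (@smoothr_id R).
  exact: smoothrD (smoothrD sF (smoothrN sQ)) sc.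
have dH c x : derive1 (fun x =>
  F x - Q x + c * x) x = derive1 F x - q x + (p + c).
  have := is_deriveD (is_deriveB (smoothr_is_derive x sF) (dQ x))
     (@is_deriveZ R R^o R^o id c x 1 1 (is_derive_id x 1)).
  move=> d; rewrite derive1E.
  have -> : 'D_1 (fun x => F x - Q x + c * x) x = _ :=
    @derive_val _ _ _ _ _ _ _ d.
  by rewrite -[_ *: _]/(_ * _); ring.
(* Over a full period [F - Q - p x] changes by [-2 pi p], while its derivative [F' - q] is at most
   [e]. *)
have pe : `|p| <= e.
  have := MVT_bound (pi *+ 2) 0 (sH (- p)) (B := e).
  have FT : F (pi *+ 2) = F 0 by rewrite -[pi *+ 2]add0r pF.
  have QT : Q (pi *+ 2) = Q 0 by rewrite -[pi *+ 2]add0r pQ.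
  rewrite FT QT mulr0 addr0.
  have -> : F 0 - Q 0 + - p * (pi *+ 2) - (F 0 - Q 0) = - p * (pi *+ 2) by ring.
  rewrite subr0 normrM normrN ler_pM2r ?normr_gt0 ?gt_eqF //; apply=> z.
  by rewrite dH addrN addr0; exact: (He 0%N z isT).
pose K := fun x => F x - (Q x + (F 0 - Q 0)).
have KE : K = fun x => F x - Q x + 0 * x + (- (F 0 - Q 0)).
  by apply/funext => x; rewrite /K; ring.
have sK : smoothr K by rewrite KE; apply: smoothrD;
  [exact: sH|exact: smoothr_cst].
have dK : derive1 K = fun x => (derive1 F x - q x) + p.
  rewrite KE (derive1D_smooth (sH 0) (@smoothr_cst R (- (F 0 - Q 0)))).
  by apply/funext => x; rewrite dH derive1_cst !addr0.
have sdK : small n (e + e) (derive1 K).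
  rewrite dK; apply: (smallD _ (@smoothr_cst R p) He); last exact: small_cst.
  exact: smoothrD (smoothr_derive1 sF) (smoothrN sq).
apply: smallS; last by apply: smallW sdK => //; lra.
have pK : periodic K (pi *+ 2) by move=> x; rewrite /K pF pQ.
move=> x; have [k [y /andP[y0 yT] ->]] := periodic_reduce T0 x.
rewrite -[X in `|X|]/(K (y + pi *+ 2 *~ k)) (periodicz pK).
have K0 : K 0 = 0 by rewrite /K; ring.
(* The derivative of [K] is at most [2 e] and a period is shorter than 8: hence the factor 16. *)
have := MVT_bound y 0 sK (fun z => sdK 0%N z isT).
rewrite K0 !subr0 (ger0_norm y0) => /le_trans; apply.
rewrite mulr2n in yT; nra.
Qed.

(** At [z = e^(i x)] this is [cos^2 (x/2)]; its powers are, up to normalisation, the de la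
    Vallee-Poussin kernels. *)
Definition kern (z : R[i]) : R[i] := (1 + z) ^+ 2 / (4 * z).

Lemma kernX z N : z != 0 -> kern z ^+ N =
  \sum_(k < (N + N).+1) ('C(N + N, k)%:R / 4 ^+ N) * z ^ (k%:Z - N%:Z).
Proof.
move=> z0; rewrite /kern expr_div_n -exprM mul2n -addnn exprDn mulr_suml.
apply: eq_bigr => k _; rewrite expr1n mul1r exprMn expfzDr // -exprnN -exprnP.
rewrite -mulr_natl; field.
by rewrite expf_neq0 // expf_neq0 // pnatr_eq0.
Qed.

Lemma invr_conjc (z : R[i]) : `|z| = 1 -> z^-1 = (z^*)%C.
Proof.
move=> z1; have z0 : z != 0 by rewrite -normr_eq0 z1 oner_eq0.
apply: (mulfI z0); rewrite divff //.
by rewrite -sqr_normc z1 expr1n.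
Qed.

Lemma kern_ge0 z : `|z| = 1 -> 0 <= kern z.
Proof.
move=> z1; have z0 : z != 0 by rewrite -normr_eq0 z1 oner_eq0.
have -> : kern z = `|1 + z| ^+ 2 / 4.
  have cE : ((1 + z)^*)%C = 1 + z^-1.
    rewrite invr_conjc //; case: (z) => a b; apply/eqP.
    by rewrite eq_complex /= opprD oppr0 !eqxx.
  rewrite sqr_normc cE /kern; field.
  by rewrite z0.
by rewrite divr_ge0 // exprn_ge0.
Qed.

(** Both sides are [4 sin^2 (x/2)]. Squared distances are thus affine in the kernel, so averaging
    them against [kern ^+ N] only involves averages of [kern ^+ N] and [kern ^+ N.+1]. *)
Lemma kern_dist z : `|z| = 1 -> `|1 - z| ^+ 2 = 4 * (1 - kern z).
Proof.
move=> z1; have z0 : z != 0 by rewrite -normr_eq0 z1 oner_eq0.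
have cE : ((1 - z)^*)%C = 1 - z^-1.
  rewrite invr_conjc //; case: (z) => a b; apply/eqP.
  by rewrite eq_complex /=; apply/andP; split; apply/eqP; ring.
rewrite sqr_normc cE /kern; field.
by rewrite z0.
Qed.

Definition root_unity (M : nat) (j : nat) : circle R :=
  expi (pi *+ 2 / M%:R * j%:R).

Lemma sum_root_unity (M : nat) (m : int) : (`|m| < M)%N ->
  \sum_(j < M) (val (root_unity M j) : R[i]) ^ m = if m == 0 then M%:R else 0.
Proof.
move=> mM; have M0 : (0 < M)%N by exact: leq_ltn_trans mM.
have MR0 : (M%:R : R) != 0 by rewrite pnatr_eq0 -lt0n.
case: eqVneq => [->|m0].
  rewrite (eq_bigr (fun=> 1)); last by move=> j _; rewrite expr0z.
  by rewrite sumr_const card_ord.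
pose y : R := pi *+ 2 / M%:R *~ m.
pose r : R[i] := val (expi y).
have E j : (val (root_unity M j) : R[i]) ^ m = r ^+ j.
  rewrite /root_unity expi_exprz exprnP expi_exprz -pmulrn /y;
    congr (val (expi _)).
  rewrite -[RHS]mulr_natr -[in RHS]mulrzr -[LHS]mulrzr; exact: mulrAC.
rewrite (eq_bigr (fun j : 'I_M => r ^+ j)); last by move=> j _; exact: E.
have rM : r ^+ M = 1.
  rewrite exprnP expi_exprz -pmulrn /y -[X in expi X]mulr_natr.
  rewrite -[_ *~ m]mulrzr mulrAC divfK // mulrzr.
  by rewrite -expi_exprz -[pi *+ 2]add0r expi_periodic expi0 /= exp1rz.
have r1 : r != 1.
  have pi0 := @pi_gt0 R.
  (* Here [y / 2 = pi m / M] with [0 < |m| < M], and the real part of [r] is [1 - 2 sin^2 (y/2)]. *)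
  have sy : sin (y / 2) != 0.
    have yE : y / 2 = pi * ((m%:~R : R) / M%:R).
      by rewrite /y -[_ *~ m]mulrzr mulr2n; field.
    have [mp|mn] := ltP 0 m.
      rewrite gt_eqF // yE sin_gt0_pi // mulr_gt0 ?divr_gt0 ?ltr0z ?ltr0n //=.
      rewrite gtr_pMr // ltr_pdivrMr ?ltr0n // mul1r.
      rewrite -[X in X < _]/(m%:~R) -(gtz0_abs mp) -pmulrn ltr_nat; exact: mM.
    have mn' : m < 0 by rewrite lt_neqAle m0.
    have -> : y / 2 = - (pi * ((`|m|%N%:R : R) / M%:R)).
      have -> : (`|m|%N%:R : R) = - m%:~R.
        by rewrite (pmulrn (1 : R) `|m|%N) ltz0_abs // mulrNz.
      by rewrite yE mulNr mulrN opprK.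
    rewrite sinN oppr_eq0 gt_eqF // sin_gt0_pi // mulr_gt0 ?divr_gt0 ?ltr0n
      ?absz_gt0 //=.
    by rewrite gtr_pMr // ltr_pdivrMr ?ltr0n // mul1r ltr_nat.
  apply: contra sy => /eqP rE.
  have /(congr1 (@complex.Re R)) /= : r = 1 by exact: rE.
  have {1}-> : y = (y / 2) *+ 2 by rewrite mulr2n; field.
  rewrite cos_mulr2n cos2sin2 mulr2n => H.
  have /eqP : sin (y / 2) ^+ 2 = 0 by lra.
  by rewrite sqrf_eq0.
apply/eqP; rewrite -(mulrI_eq0 _ (x := r - 1)) ?subr_eq0 //; last first.
  by apply/lregP; rewrite subr_eq0.
by rewrite -subrX1 rM subrr.
Qed.

(** The frequencies of [kern ^+ N] lie between [-N] and [N], so with [M > N] nodes only the constant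
    one, the central binomial term, survives the summation. *)
Lemma sum_kern (N M : nat) (x : circle R) : (N < M)%N ->
  \sum_(j < M) kern (val x / val (root_unity M j)) ^+ N =
  M%:R * ('C(N + N, N)%:R / 4 ^+ N).
Proof.
move=> NM; under eq_bigr => j _.
  rewrite kernX; last by rewrite mulf_neq0 ?invr_eq0 ?circle_neq0.
  over.
rewrite exchange_big /=.
have NN : (N < (N + N).+1)%N by rewrite ltnS leq_addr.
rewrite (bigD1 (Ordinal NN)) //= [X in _ + X]big1 ?addr0.
  rewrite subrr (eq_bigr (fun=> 'C(N + N, N)%:R / 4 ^+ N)); last first.
    by move=> j _; rewrite expr0z mulr1.
  by rewrite sumr_const card_ord [RHS]mulr_natl.
move=> k kN; rewrite -mulr_sumr.
rewrite (eq_bigr (fun j : 'I_M => (val x : R[i]) ^ (k%:Z - N%:Z) *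
   (val (root_unity M j) : R[i]) ^ (N%:Z - k%:Z))); last first.
  by move=> j _; rewrite expfzMl exprz_inv opprB.
rewrite -mulr_sumr sum_root_unity; last by have := ltn_ord k; lia.
rewrite ifF ?mulr0 //; apply/negbTE; rewrite subr_eq0 eq_sym.
by apply: contra kN => /eqP [kN]; apply/eqP/val_inj.
Qed.

(** The ratio of consecutive central binomials, which compares the masses of [kern ^+ N.+1] and
    [kern ^+ N]. *)
Lemma bin_central (N : nat) :
  (N.+1 * 'C(N.+1 + N.+1, N.+1) = 2 * (N + N).+1 * 'C(N + N, N))%N.
Proof.
have := mul_bin_diag (N + N).+2 N; have := mul_bin_down (N + N).+1 N.
rewrite addSn addnS /= (_ : (N + N).+1 - N = N.+1)%N; last by lia.
move: 'C(_, N.+1) 'C((N + N).+1, N) 'C(N + N, N) => A B C; nia.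
Qed.

Lemma chord_norm (x y : R) :
  `|(val (expi x) : R[i]) - val (expi y)| = (2 * `|sin ((x - y) / 2)|)%:C%C.
Proof.
rewrite normc_def /=; congr (_%:C)%C.
rewrite -[RHS]ger0_norm ?mulr_ge0 // -sqrtr_sqr; congr Num.sqrt.
rewrite exprMn real_normK ?num_real //.
have := cosB x y; have {1}-> : x - y = ((x - y) / 2) *+ 2 by rewrite mulr2n;
  field.
rewrite cos_mulr2n cos2sin2 mulr2n => H.
have := cos2Dsin2 x; have := cos2Dsin2 y; nra.
Qed.

Lemma lipschitz_chord (F1 F2 : R -> R) (B : R) :
  smoothr F1 -> smoothr F2 -> periodic F1 (pi *+ 2) -> periodic F2 (pi *+ 2) ->
  (forall x, `|derive1 F1 x| <= B) -> (forall x, `|derive1 F2 x| <= B) ->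
  forall x y, `|(F1 x +i* F2 x)%C - (F1 y +i* F2 y)%C| <=
    (4 * B)%:C%C * `|(val (expi x) : R[i]) - val (expi y)|.
Proof.
move=> s1 s2 p1 p2 B1 B2 x y; rewrite chord_norm -rmorphM /=.
have := @normc_le R ((F1 x +i* F2 x)%C - (F1 y +i* F2 y)%C) _
  (periodic_chord x y p1 s1 B1) (periodic_chord x y p2 s2 B2).
by move=> /le_trans; apply; rewrite lecR; lra.
Qed.

(* Averaging F over the M-th roots of unity against the kernel kern^N, whose
   mass is exactly computable and concentrates near 1 as N grows. *)
Lemma trig_dense0 (F1 F2 : R -> R) (e : R) :
  smoothr F1 -> smoothr F2 -> periodic F1 (pi *+ 2) -> periodic F2 (pi *+ 2) ->
  0 < e -> exists2 q, trig q & forall x,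
    `|F1 x - reA q x| <= e /\ `|F2 x - imA q x| <= e.
Proof.
move=> s1 s2 p1 p2 e0.
have pi0 := @pi_gt0 R; have T0 : (0 : R) < pi *+ 2 by rewrite mulr2n; lra.
have [B1 HB1] := periodic_bounded_derivatives T0 p1 s1 1.
have [B2 HB2] := periodic_bounded_derivatives T0 p2 s2 1.
pose B := Num.max B1 B2; pose L := 4 * B.
have HB1' x : `|derive1 F1 x| <= B by rewrite (le_trans (HB1 x)) // le_max lexx.
have HB2' x : `|derive1 F2 x| <= B by rewrite (le_trans (HB2 x)) // le_max lexx
  orbT.
have HL := @lipschitz_chord F1 F2 B s1 s2 p1 p2 HB1' HB2'.
have L0 : 0 <= L.
  by rewrite mulr_ge0 // (le_trans _ (_ :
    B1 <= B)) ?(le_trans _ (HB1 0)) // le_max lexx.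
(* Chosen so that the final error term [L^2 / (e (N + 1))] is at most [e / 2]. *)
have [N HN] : exists N : nat, L ^+ 2 / e ^+ 2 * 2 < N%:R.
  exists (Num.bound (L ^+ 2 / e ^+ 2 * 2)).
  by apply: archi_boundP; rewrite mulr_ge0 // divr_ge0 // sqr_ge0.
(* Enough nodes for the exact summation of both [kern ^+ N] and [kern ^+ N.+1]. *)
pose M := N.+2.
pose w j := root_unity M j; pose y j : R := pi *+ 2 / M%:R * j%:R.
pose F x : R[i] := (F1 x +i* F2 x)%C.
pose cN : R[i] := 'C(N + N, N)%:R / 4 ^+ N.
pose cS : R[i] := 'C(N.+1 + N.+1, N.+1)%:R / 4 ^+ N.+1.
have cN0 : 0 < cN by rewrite divr_gt0 ?exprn_gt0 // ltr0n bin_gt0 leq_addr.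
(* Hence [1 - kern] has mean [1 / (2 (N + 1))] for the normalised weights [kern ^+ N]. *)
have cSE : cS = cN * ((N + N).+1%:R / (2 * N.+1%:R)).
  have E : (N.+1%:R : R[i]) * 'C(N.+1 + N.+1, N.+1)%:R =
      2 * (N + N).+1%:R * 'C(N + N, N)%:R by rewrite -!natrM bin_central.
  apply: (mulfI (_ : (N.+1%:R : R[i]) != 0)); first by rewrite pnatr_eq0.
  rewrite /cS mulrA E /cN exprS; field.
  by rewrite expf_neq0 ?pnatr_eq0 //= -(natrD _ 1) pnatr_eq0.
have M0 : (M%:R : R[i]) != 0 by rewrite pnatr_eq0.
have cNn0 : cN != 0 by rewrite gt_eqF.
pose q : test_fun R := \sum_(j < M) ((M%:R * cN)^-1 * F (y j)) *:
  \sum_(k < (N + N).+1) (('C(N + N, k)%:R / 4 ^+ N) * (val (w j) :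
    R[i]) ^ (N%:Z - k%:Z)) *:
    chi (k%:Z - N%:Z).
have tq : trig q.
  by do 2! [apply: trig_sum => ?; apply: trigZ]; exact: trig_chi.
have qE t : q t = \sum_(j < M) (M%:R * cN)^-1 * F (y j) * kern (val t / val (w
  j)) ^+ N.
  rewrite /q test_sumE; apply: eq_bigr => j _; rewrite test_scaleE test_sumE.
  congr (_ * _); rewrite kernX;
    last by rewrite mulf_neq0 ?invr_eq0 ?circle_neq0.
  apply: eq_bigr => k _; rewrite test_scaleE -[LHS]mulrA; congr (_ * _).
  by rewrite expfzMl exprz_inv opprB mulrC.
exists q => // x.
suff H : `|F x - q (expi x)| <= e%:C%C.
  by split; [have := Re_le_normc H|have := Im_le_normc H]; rewrite raddfB.
pose z j : R[i] := val (expi x) / val (w j).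
have z1 j : `|z j| = 1 by rewrite normrM normfV !circle_normE divr1.
have FE : F x = \sum_(j < M) (M%:R * cN)^-1 * F x * kern (z j) ^+ N.
  rewrite -mulr_sumr sum_kern ?ltnS ?leqnSn //.
  by rewrite mulrAC mulVf ?mul1r // mulf_neq0.
have eC0 : 0 < e%:C%C by rewrite ltcR.
have LC0 : 0 <= L%:C%C by rewrite lecR.
(* The Lipschitz bound [L |1 - z|] is at most [e/2 + L^2 |1 - z|^2 / (2 e)] by the inequality of
   means, and [kern_dist] rewrites the square. *)
have step j : `|F x - F (y j)| <= e%:C%C / 2 + (2 * L%:C%C ^+ 2 / e%:C%C) * (1
  - kern (z j)).
  apply: le_trans (HL x (y j)) _.
  have -> : `|(val (expi x) : R[i]) - val (expi (y j))| = `|1 - z j|.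
    rewrite -[RHS]mul1r -[X in _ = X * _](circle_normE (w j)) -normrM mulrBr
      mulr1 /z mulrCA.
    by rewrite divff ?circle_neq0 // mulr1 distrC.
  rewrite -subr_ge0.
  have -> : e%:C%C / 2 + 2 * L%:C%C ^+ 2 / e%:C%C * (1 - kern (z j)) -
      (4 * B)%:C%C * `|1 - z j| = (e%:C%C - L%:C%C * `|1 - z j|) ^+ 2 / (2 *
        e%:C%C).
    rewrite sqrrB exprMn kern_dist // -[(4 * B)%:C%C]/(L%:C%C); field.
    by rewrite gt_eqF.
  apply: divr_ge0; last by rewrite mulr_ge0 // ltW.
  rewrite real_exprn_even_ge0 // realB //.
    by rewrite realE (ltW eC0).
  by rewrite realE mulr_ge0.
rewrite FE qE -sumrB; apply: le_trans (ler_norm_sum _ _ _) _.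
have McN0 : 0 <= (M%:R * cN)^-1 by rewrite invr_ge0 mulr_ge0 // ltW.
apply: (@le_trans _ _ (\sum_(j < M) (M%:R * cN)^-1 *
    (e%:C%C / 2 + (2 * L%:C%C ^+ 2 / e%:C%C) * (1 - kern (z j))) * kern (z j)
      ^+ N)).
  apply: ler_sum => j _; rewrite -mulrBl -mulrBr normrM normrM.
  have k0 : 0 <= kern (z j) ^+ N by rewrite exprn_ge0 // kern_ge0.
  rewrite [X in _ * X <= _]ger0_norm // ler_wpM2r // [X in X * _ <= _]ger0_norm
    //.
  by rewrite ler_wpM2l.
rewrite (eq_bigr (fun j : 'I_M =>
   (M%:R * cN)^-1 * (e%:C%C / 2 + 2 * L%:C%C ^+ 2 / e%:C%C) * kern (z j) ^+ N
   - (M%:R * cN)^-1 * (2 * L%:C%C ^+ 2 / e%:C%C) * kern (z j) ^+ N.+1));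
       last first.
  by move=> j _; rewrite [kern (z j) ^+ N.+1]exprS; ring.
rewrite sumrB -!mulr_sumr !sum_kern ?ltnSn ?ltnS ?leqnSn //.
rewrite -/cN -/cS cSE.
set K : R[i] := (N.+1%:R : R[i]).
have K0 : K != 0 by rewrite pnatr_eq0.
have KE : K = (N.+1%:R)%:C%C by rewrite rmorph_nat.
have -> : ((N + N).+1%:R : R[i]) = 2 * K - 1.
  have -> : 2 * K = (N + N).+2%:R by rewrite -natrM mul2n -addnn addSn addnS.
  by rewrite -[X in _ = X - 1]natr1 addrK.
clearbody K.
have -> : (M%:R * cN)^-1 * (e%:C%C / 2 + 2 * L%:C%C ^+ 2 / e%:C%C) * (M%:R *
  cN) -
   (M%:R * cN)^-1 * (2 * L%:C%C ^+ 2 / e%:C%C) * (M%:R * (cN * ((2 * K - 1) /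
     (2 * K)))) =
   e%:C%C / 2 + L%:C%C ^+ 2 / e%:C%C / K.
  by field; rewrite K0 M0 cNn0 gt_eqF.
have -> : e%:C%C / 2 + L%:C%C ^+ 2 / e%:C%C / K = (e / 2 + L ^+ 2 / e /
  N.+1%:R)%:C%C.
  rewrite KE -[X in _ / X + _](rmorph_nat (real_complex R)) -rmorphXn.
  by rewrite -!fmorphV -!rmorphM -rmorphD.
rewrite lecR.
suff H : L ^+ 2 / e / N.+1%:R <= e / 2 by rewrite [leRHS]splitr lerD2l.
rewrite ler_pdivrMr ?ltr0n // ler_pdivrMr //.
have HN' : L ^+ 2 / e ^+ 2 * 2 <= N.+1%:R.
  by rewrite ltW // (lt_le_trans HN) // ler_nat.
move: HN'; rewrite mulrAC ler_pdivrMr ?exprn_gt0 //; nra.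
Qed.

Lemma trig_dense n (F1 F2 : R -> R) (e : R) :
  smoothr F1 -> smoothr F2 -> periodic F1 (pi *+ 2) -> periodic F2 (pi *+ 2) ->
  0 < e -> exists2 q, trig q &
    small n e (fun x => F1 x - reA q x) /\ small n e (fun x => F2 x - imA q x).
Proof.
elim: n F1 F2 e => [|n IH] F1 F2 e s1 s2 p1 p2 e0.
  have [q tq Hq] := trig_dense0 s1 s2 p1 p2 e0; exists q => //.
  by split=> -[|//] x _; have [] := Hq x.
have e16 : 0 < e / 16 by lra.
have [q tq [H1 H2]] := IH _ _ _ (smoothr_derive1 s1) (smoothr_derive1 s2)
  (periodic_derive1 p1 s1) (periodic_derive1 p2 s2) e16.
have [Q [p tQ HQ]] := trig_antiderivative tq.
(* The constant of integration, making the approximant agree with the function at angle 0. *)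
pose d := ((F1 0 - reA Q 0) +i* (F2 0 - imA Q 0))%C.
exists (d *: chi 0 + Q); first exact: trigZD.
have E : 16 * (e / 16) = e by lra.
split.
- have -> : reA (d *: chi 0 + Q) = fun x => reA Q x + (F1 0 - reA Q 0).
    apply/funext => x; rewrite -[LHS]/(complex.Re ((d *:
      chi 0) (expi x) + Q (expi x))).
    by rewrite raddfD addrC -[X in _ + X = _]/(reA (d *:
      chi 0) x) reA_chi mul0r cos0 sin0 mulr1 mulr0 subr0.
  have := antiderivative_small s1 (@reA_smooth R Q) (@reA_smooth R q) p1
    (@reA_periodic R Q)
    (fun x => (HQ x).1) H1.
  by rewrite E.
- have -> : imA (d *: chi 0 + Q) = fun x => imA Q x + (F2 0 - imA Q 0).
    apply/funext => x; rewrite -[LHS]/(complex.Im ((d *: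
      chi 0) (expi x) + Q (expi x))).
    by rewrite raddfD addrC -[X in _ + X = _]/(imA (d *:
      chi 0) x) imA_chi mul0r cos0 sin0 mulr1 mulr0 add0r.
  have := antiderivative_small s2 (@imA_smooth R Q) (@imA_smooth R q) p2
    (@imA_periodic R Q)
    (fun x => (HQ x).2) H2.
  by rewrite E.
Qed.

(** * Distributions are determined by their Fourier coefficients *)

Lemma circle_dist_ext (a b : circle_dist R) : a =1 b -> a = b.
Proof.
case: a b => [[a ca] cta] [[b cb] ctb] /= /funext E.
case: _ / E cb ctb => cb ctb.
case: ca cta => [[h1] [h2]] cta; case: cb ctb => [[h3] [h4]] ctb.
move: cta ctb; rewrite (Prop_irrelevance h1 h3) (Prop_irrelevance h2 h4) =>
  cta ctb.
by rewrite (Prop_irrelevance cta ctb).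
Qed.

Lemma fourier_inj (a b : circle_dist R) :
  (forall n, fourier a n = fourier b n) -> a = b.
Proof.
move=> ab; apply: circle_dist_ext => f.
have chiE n : a (chi n) = b (chi n).
  by have := ab (- n); rewrite /fourier opprK.
have trigE q : trig q -> a q = b q.
  elim=> [|c n g _ IH]; first by rewrite !linear0.
  by rewrite !linearP IH chiE.
have [n [C C0 HC]] := dist_boundedP a; have [m [D D0 HD]] := dist_boundedP b.
apply/eqP; rewrite -subr_eq0 -normr_le0; apply/ler_addgt0Pr => e e0.
have eR : e = (complex.Re e)%:C%C by apply/esym/RRe_real; rewrite realE ltW.
have e0' : 0 < complex.Re e by rewrite eR ltcR in e0.
have d0 : 0 < complex.Re e / (C + D + 1) by rewrite divr_gt0 //; lra.
have [q tq [H1 H2]] := trig_dense (maxn n m) (@reA_smooth R f) (@imA_smooth R f)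
  (@reA_periodic R f) (@imA_periodic R f) d0.
have fq : csmall (maxn n m) (complex.Re e / (C + D + 1)) (f - q).
  split.
  - have -> : reA (f - q) = fun x => reA f x - reA q x by apply/funext => x;
      rewrite -[LHS]/(derive1n 0 (reA (f - q)) x) reA_sub.
    exact: H1.
  - have -> : imA (f - q) = fun x => imA f x - imA q x by apply/funext => x;
      rewrite -[LHS]/(derive1n 0 (imA (f - q)) x) imA_sub.
    exact: H2.
have -> : a f - b f = a (f - q) - b (f - q).
  have -> : a (f - q) = a f - a q by exact: linearB.
  have -> : b (f - q) = b f - b q by exact: linearB.
  by rewrite (trigE _ tq) opprB addrA subrK.
rewrite add0r; apply: le_trans (ler_normB _ _) _.
have Ha := HC _ _ d0 (csmallW (leq_maxl n m) (lexx _) fq).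
have Hb := HD _ _ d0 (csmallW (leq_maxr n m) (lexx _) fq).
apply: le_trans (lerD Ha Hb) _; rewrite -rmorphD /= eR lecR -mulrDl.
rewrite mulrA ler_pdivrMr; last by lra.
by nra.
Qed.

End TrigPoly.

(** * Integration over the circle *)

Section Mean.
Context {R : realType}.
Implicit Types F G : R -> R.
Local Notation mu := (@lebesgue_measure R).

(** Continuity is asked only inside the interval because the regularised integrands of sigma may
    jump at the point 1, that is at the angles 0 and [2 pi]. *)
Definition tame F := {in `]0, (2 * pi)[%classic, continuous F} /\
  exists B : R, forall x, `|F x| <= B.

Lemma tame_integrable F : tame F -> mu.-integrable `[0,
  (2 * pi)]%classic (EFin \o F).
Proof.
move=> [cF [B HB]]; apply: measurable_bounded_integrable.
- exact: measurable_itv.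
- by rewrite /= lebesgue_measure_itv /=; case: ifP => // _; rewrite ltry.
- apply/measurable_realfun.measurable_fun_itv_bndo_bndcP/measurable_realfun.measurable_fun_itv_obnd_cbndP.
  by apply: measurable_realfun.open_continuous_measurable_fun => //;
    exact: interval_open.
- exists B; split; first exact: num_real.
  by move=> M BM x _ /=; apply: le_trans (ltW BM).
Qed.

Lemma tame_periodic F : smoothr F -> periodic F (pi *+ 2) -> tame F.
Proof.
move=> sF pF; split; first by move=> x _; exact: smoothr_continuous.
by apply: (periodic_bounded _ pF sF); rewrite mulr2n addr_gt0 // pi_gt0.
Qed.

Lemma tameD F G : tame F -> tame G -> tame (fun x => F x + G x).
Proof.
move=> [cF [B HB]] [cG [C HC]]; split.
  by move=> x xI; apply: continuousD; [exact: cF|exact: cG].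
by exists (B + C) => x; apply: le_trans (ler_normD _ _) _; apply: lerD.
Qed.

Lemma tameZ c F : tame F -> tame (fun x => c * F x).
Proof.
move=> [cF [B HB]]; split.
  by move=> x xI; apply: continuousM; [exact: cvg_cst|exact: cF].
by exists (`|c| * B) => x; rewrite normrM ler_wpM2l.
Qed.

Definition rmean F : R := (2 * pi)^-1 * \int[mu]_(x in `[0%R, (2 * pi)]) F x.

Let mI : @measurable _ (measurableTypeR R) `[0%R, (2 * pi)]%classic.
Proof. exact: measurable_itv. Qed.

Lemma rmeanD F G : tame F -> tame G -> rmean (fun x =>
  F x + G x) = rmean F + rmean G.
Proof.
move=> /tame_integrable iF /tame_integrable iG.
by rewrite /rmean (RintegralD mI iF iG) mulrDr.
Qed.

Lemma rmeanZ c F : tame F -> rmean (fun x => c * F x) = c * rmean F.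
Proof.
move=> /tame_integrable iF.
by rewrite /rmean (RintegralZl _ mI iF) mulrCA.
Qed.

Lemma twopi_gt0 : (0 : R) < 2 * pi.
Proof. by rewrite mulr_gt0 // pi_gt0. Qed.

Lemma rmean_le F B : tame F -> (forall x, `|F x| <= B) -> `|rmean F| <= B.
Proof.
move=> tF HB; have T0 := twopi_gt0;
  rewrite /rmean normrM gtr0_norm ?invr_gt0 //.
rewrite ler_pdivrMl //.
have iF := tame_integrable tF.
apply: le_trans (le_normr_Rintegral mI iF) _.
have H : \int[mu]_(x in `[0%R, (2 * pi)]) B = 2 * pi * B.
  rewrite Rintegral_cst //= lebesgue_measure_itv /= lte_fin T0 sube0 /=.
  exact: mulrC.
rewrite -H; apply: le_Rintegral => //.
- have : tame (fun x => `|F x|).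
    case: tF => cF [C HC]; split; last by exists C => x; rewrite normr_id.
    by move=> x xI; apply: cvg_norm; exact: cF.
  exact: tame_integrable.
- apply: (tame_integrable (F := fun=> B)); split.
    by move=> x _; exact: cvg_cst.
  by exists `|B|.
Qed.

(** The two endpoints are a null set; this absorbs the junk value of the integrands at the point
    1. *)
Lemma rmean_eq F G : tame F -> tame G ->
  (forall x, 0 < x < 2 * pi -> F x = G x) -> rmean F = rmean G.
Proof.
move=> tF tG FG; rewrite /rmean; congr (_ * _).
have E H : tame H -> \int[mu]_(x in `[0%R, (2 * pi)]) H x =
    \int[mu]_(x in `]0%R, (2 * pi)[) H x.
  move=> /tame_integrable iH.
  rewrite -Rintegral_itv_obnd_cbnd; last first.
    apply: (integrableS _ _ _ iH);
      [exact: measurable_itv|exact: measurable_itv|].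
    exact: subset_itv_oc_cc.
  rewrite -Rintegral_itv_bndo_bndc //.
  apply: (integrableS _ _ _ iH); [exact: measurable_itv|exact: measurable_itv|].
  exact: subset_itv_oo_cc.
rewrite !E //; apply: eq_Rintegral => x; rewrite inE /= in_itv /=; exact: FG.
Qed.

Lemma rmean_derive1 F : smoothr F -> periodic F (pi *+ 2) ->
  rmean (derive1 F) = 0.
Proof.
move=> sF pF; have T0 := twopi_gt0.
have cF := smoothr_continuous sF; have sF' := smoothr_derive1 sF.
rewrite /rmean /Rintegral (continuous_FTC2 (F := F)) //.
- have -> : 2 * pi = 0 + pi *+ 2 :> R by rewrite add0r mulr2n; ring.
  by rewrite pF subee // mulr0.
- exact: continuous_subspaceT (smoothr_continuous sF').
- split.
  + by move=> x _; exact: (sF 0%N).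
  + apply: cvg_at_right_filter; exact: cF.
  + apply: cvg_at_left_filter; exact: cF.
Qed.

Lemma rmean_cst c : rmean (fun=> c) = c.
Proof.
have T0 := twopi_gt0; rewrite /rmean Rintegral_cst; last exact: measurable_itv.
rewrite /= lebesgue_measure_itv /= lte_fin T0 sube0 /=.
by rewrite mulrCA mulVf ?mulr1 // gt_eqF.
Qed.

(** A positive value would persist on an interval of positive length inside the period, whereas a
    nonnegative function of integral zero vanishes almost everywhere. *)
Lemma rmean_eq0 F : continuous F -> tame F -> (forall x,
  0 <= F x) -> rmean F = 0 ->
  forall x, 0 <= x <= 2 * pi -> F x = 0.
Proof.
move=> cF tF F0 HF x /andP[x0 x1]; apply/eqP; case: eqVneq => // Fx.
have T0 := twopi_gt0.
have Fx0 : 0 < F x by rewrite lt_neqAle eq_sym Fx F0.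
have [r /= r0 Hr] : \forall e \near 0^'+, forall y, `|x - y| < e -> 0 < F y.
  have := cF x; move/cvgrPdist_lt => /(_ _ Fx0) /nbhs_ballP[e /= e0 He].
  exists e => // d /=; rewrite sub0r normrN => de d0 y xy.
  have := He y (lt_le_trans xy (ltW (le_lt_trans (ler_norm _) de))) => /=.
  by rewrite ltr_distlC subrr => /andP[].
have {r0 Hr}[e e0 He] : exists2 e, 0 < e & forall y, `|x - y| < e -> 0 < F y.
  exists (r / 2); first by rewrite divr_gt0.
  apply: Hr => /=; last by rewrite divr_gt0.
  by rewrite sub0r normrN gtr0_norm ?divr_gt0 //; lra.
pose u := Num.max 0 (x - e); pose v := Num.min (2 * pi) (x + e).
have uv : u < v by rewrite gt_max !lt_min; apply/andP; split; apply/andP;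
  split; lra.
have iF := tame_integrable tF; have [mF _] := integrableP _ _ _ iF.
have I0 : (\int[mu]_(x in `[0%R, (2 * pi)%R]) `|(EFin \o F) x|)%E = 0%E.
  have -> : (fun x => `|(EFin \o F) x|%E) = EFin \o F.
    by apply/funext => y; rewrite /= ger0_norm.
  move: HF; rewrite /rmean /Rintegral => /eqP;
    rewrite mulf_eq0 invr_eq0 gt_eqF //=.
  rewrite fine_eq0 ?(integrable_fin_num mI iF) // => /eqP; exact.
have /(ae_eq_integral_abs mu mI mF) [N [mN N0 HN]] := I0.
have uvN : `]u, v[%classic `<=` N.
  move=> y /=; rewrite in_itv /= gt_max lt_min =>
    /andP[/andP[y0 y1] /andP[y2 y3]].
  apply: HN => /= /(_ _) H.
  have : (F y)%:E = 0%E by apply: H; rewrite in_itv /= !ltW.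
  move=> -[] Fy; have := He y; rewrite Fy ltxx; move=> /(_ _)/notF; apply.
  by rewrite ltr_norml; apply/andP; split; lra.
have : (mu `]u, v[%classic <= mu N)%E.
  by apply: le_measure => //; rewrite inE //; exact: measurable_itv.
rewrite N0 /= lebesgue_measure_itv /= lte_fin uv -EFinB lee_fin; lra.
Qed.

End Mean.

(** * Reflection of distributions *)

Section CircleMean.
Context {R : realType}.
Implicit Types (f h : test_fun R) (g : circle R -> R[i]^o).

Definition ctame g := tame (reA g) /\ tame (imA g).

Lemma mean_linear (c : R[i]) g1 g2 : ctame g1 -> ctame g2 ->
  circle_mean (fun t => c * g1 t + g2 t) = c * circle_mean g1 + circle_mean g2.
Proof.
move=> [r1 i1] [r2 i2]; case: c => a b.
have E1 : reA (fun t => (a +i* b)%C * g1 t + g2 t) =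
    fun x => a * reA g1 x + (- b * imA g1 x + reA g2 x).
  by apply/funext => x; rewrite /reA /imA;
    case: (g1 _) (g2 _) => ? ? [? ?] /=; ring.
have E2 : imA (fun t => (a +i* b)%C * g1 t + g2 t) =
    fun x => a * imA g1 x + (b * reA g1 x + imA g2 x).
  by apply/funext => x; rewrite /reA /imA;
    case: (g1 _) (g2 _) => ? ? [? ?] /=; ring.
have mE g : circle_mean g = (rmean (reA g) +i* rmean (imA g))%C by [].
have tz c F : tame F -> tame (fun x => c * F x) by exact: tameZ.
rewrite !mE E1 E2 !rmeanD ?rmeanZ //; try by apply: tameD => //; exact: tz.
- by apply/eqP; rewrite eq_complex /=; apply/andP; split; apply/eqP; ring.
- exact: tz.
- exact: tz.
- exact: tz.
- exact: tz.
Qed.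

Lemma mean_le (B : R) g : ctame g -> (forall t, `|g t : R[i]| <= B%:C%C) ->
  `|circle_mean g : R[i]| <= (2 * B)%:C%C.
Proof.
move=> [r1 i1] HB; apply: normc_le.
- by apply: (rmean_le r1) => x; exact: Re_le_normc (HB _).
- by apply: (rmean_le i1) => x; exact: Im_le_normc (HB _).
Qed.

Lemma sin_half_gt0 (x : R) : 0 < x < 2 * pi -> 0 < sin (x / 2).
Proof. by move=> x0; apply: sin_gt0_pi; lra. Qed.

Lemma expi_neq1 (x : R) : 0 < x < 2 * pi -> expi x <> circle_one.
Proof.
move=> /sin_half_gt0 s0 /(congr1 (fun t : circle R => complex.Re (val t))) /=.
have {1}-> : x = (x / 2) *+ 2 by rewrite mulr2n; field.
rewrite cos_mulr2n cos2sin2 mulr2n; nra.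
Qed.

Lemma mean_eq1 g1 g2 : ctame g1 -> ctame g2 ->
  (forall t, t <> circle_one -> g1 t = g2 t) -> circle_mean g1 = circle_mean g2.
Proof.
move=> [r1 i1] [r2 i2] g12.
have mE g : circle_mean g = (rmean (reA g) +i* rmean (imA g))%C by [].
rewrite !mE; congr (_ +i* _)%C; apply: rmean_eq => // x x0.
- by rewrite /reA g12 //; exact: expi_neq1.
- by rewrite /imA g12 //; exact: expi_neq1.
Qed.

Lemma test_ctame f : ctame f.
Proof.
by split; apply: tame_periodic;
  [exact: reA_smooth|exact: reA_periodic|exact: imA_smooth|exact: imA_periodic].
Qed.

(** For [n != 0] the character is the derivative of the periodic function [chi n / (i n)]. *)
Lemma mean_chi n : circle_mean (chi n : test_fun R) = (n == 0)%:R.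
Proof.
have mE g : circle_mean g = (rmean (reA g) +i* rmean (imA g))%C by [].
have E1 : reA (chi n : test_fun R) = fun x => cos (n%:~R * x).
  by apply/funext => x; rewrite -[chi n]scale1r reA_chi mul1r mul0r subr0.
have E2 : imA (chi n : test_fun R) = fun x => sin (n%:~R * x).
  by apply/funext => x; rewrite -[chi n]scale1r imA_chi mul1r mul0r addr0.
rewrite mE; have [->|n0] := eqVneq n 0.
  have -> : reA (chi 0 : test_fun R) = fun=> 1.
    by apply/funext => x; rewrite /reA [X in complex.Re X]expr0z.
  have -> : imA (chi 0 : test_fun R) = fun=> 0.
    by apply/funext => x; rewrite /imA [X in complex.Im X]expr0z.
  by rewrite !rmean_cst.
have nR0 : (n%:~R : R) != 0 by rewrite intr_eq0.
pose d : R[i] := (0 +i* - (n%:~R)^-1)%C.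
have D1 : reA (chi n : test_fun R) = derive1 (reA (d *: chi n)).
  rewrite E1; apply/funext => x; rewrite derive1E.
  have -> : reA (d *: chi n) = fun x =>
    0 * cos (n%:~R * x) + (n%:~R)^-1 * sin (n%:~R * x).
    by apply/funext => y; rewrite reA_chi /d /=; ring.
  rewrite (@derive_val _ _ _ _ _ _ _ (is_derive_trig 0 (n%:~R)^-1 n%:~R x)).
  by field.
have D2 : imA (chi n : test_fun R) = derive1 (imA (d *: chi n)).
  rewrite E2; apply/funext => x; rewrite derive1E.
  have -> : imA (d *: chi n) = fun x =>
    (- (n%:~R)^-1) * cos (n%:~R * x) + 0 * sin (n%:~R * x).
    by apply/funext => y; rewrite imA_chi /d /=; ring.
  rewrite (@derive_val _ _ _ _ _ _ _ (is_derive_trig (- (n%:~R)^-1) 0 n%:~R x)).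
  by rewrite mul0r sub0r mulNr opprK mulrA mulfV // mul1r.
rewrite D1 D2 (rmean_derive1 (@reA_smooth R (d *:
  chi n)) (@reA_periodic R (d *: chi n))).
by rewrite (rmean_derive1 (@imA_smooth R (d *: chi n)) (@imA_periodic R (d *:
  chi n))).
Qed.

Lemma csmall0_le (d : R) n f t : csmall n d f -> `|f t| <= (2 * d)%:C%C.
Proof.
move=> [H1 H2]; have [x _ <-] := expi_surj t.
by apply: normc_le; [exact: (H1 0%N)|exact: (H2 0%N)].
Qed.

Lemma csmall_lipschitz (d : R) f t u : csmall 1 d f ->
  `|f t - f u| <= (4 * d)%:C%C * `|(val t : R[i]) - val u|.
Proof.
move=> [H1 H2]; have [x _ <-] := expi_surj t; have [y _ <-] := expi_surj u.
have := @lipschitz_chord R _ _ d (@reA_smooth R f) (@imA_smooth R f)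
  (@reA_periodic R f) (@imA_periodic R f) (fun z => H1 1%N z isT) (fun z =>
    H2 1%N z isT) x y.
rewrite /reA /imA; by case: (f _) (f _) => ? ? [? ?].
Qed.

(** Any witness with the prescribed coefficients is the chosen distribution; reflection and sigma
    become computable through this lemma. *)
Lemma dist_of_fourierE (u : int -> R[i]) (a : circle_dist R) :
  (forall n, fourier a n = u n) -> dist_of_fourier u = a.
Proof.
move=> au; apply: fourier_inj => n; rewrite au.
have : exists a, [set a : circle_dist R | forall n,
  fourier a n = u n] a by exists a.
by move=> /(xgetPex dist_zero); exact.
Qed.

Lemma reflect_smooth f : smooth_off set0 (fun t => f (circle_inv t)).
Proof.
have N : smoothr (fun x : R => - x) by apply: smoothrN; exact: smoothr_id.
apply/smooth_off0P; split.
- have -> : reA (fun t => f (circle_inv t)) = reA f \o (fun x : R => - x).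
    by apply/funext => x; rewrite /reA circle_inv_expi.
  exact: smoothr_comp (@reA_smooth R f) N.
- have -> : imA (fun t => f (circle_inv t)) = imA f \o (fun x : R => - x).
    by apply/funext => x; rewrite /imA circle_inv_expi.
  exact: smoothr_comp (@imA_smooth R f) N.
Qed.

Definition test_reflect f : test_fun R := test_of (reflect_smooth f).

Lemma test_reflectE f t : test_reflect f t = f (circle_inv t). Proof. by [].
  Qed.

Lemma test_reflect_linear : linear test_reflect.
Proof. by move=> c f h; apply: test_eqP => t. Qed.

Lemma test_reflect_chi n : test_reflect (chi n) = chi (- n).
Proof.
apply: test_eqP => t; rewrite test_reflectE.
by rewrite -[LHS]/((val t : R[i])^-1 ^ n) exprz_inv.
Qed.

Lemma test_reflect_bounded : op_bounded test_reflect.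
Proof.
move=> n; exists n; exists 1 => // d f d0 [H1 H2]; rewrite mul1r;
  split => k x kn.
- have -> : reA (test_reflect f) = fun x => reA f (- x).
    by apply/funext => y; rewrite /reA test_reflectE circle_inv_expi.
  by rewrite (derive1n_opparg _ (@reA_smooth R f)) normrM normrX normrN1 expr1n
    mul1r H1.
- have -> : imA (test_reflect f) = fun x => imA f (- x).
    by apply/funext => y; rewrite /imA test_reflectE circle_inv_expi.
  by rewrite (derive1n_opparg _ (@imA_smooth R f)) normrM normrX normrN1 expr1n
    mul1r H2.
Qed.

Lemma dist_reflectE (a : circle_dist R) f :
  dist_reflect a f = a (test_reflect f).
Proof.
have lT : linear (a \o test_reflect : test_fun R -> R[i]^o).
  by move=> c g h; rewrite /= test_reflect_linear linearP.
have [b Hb] := dist_mk lT (dist_bounded_comp (dist_boundedP a)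
  test_reflect_bounded).
rewrite -[RHS]Hb; congr (dist_fun _ f); apply: dist_of_fourierE => n.
by rewrite /fourier Hb /= test_reflect_chi.
Qed.

Lemma mean_dist : exists m : circle_dist R, forall f, m f = circle_mean f.
Proof.
apply: dist_mk => [c f h|];
  first by exact: mean_linear (test_ctame f) (test_ctame h).
exists 0%N; exists 4 => // d f d0 fd.
have := mean_le (test_ctame f) (fun t => csmall0_le t fd).
by rewrite mulrA -natrM.
Qed.

(** No change of variables: the mean is itself a distribution, and its Fourier coefficients, 1 at 0
    and 0 elsewhere, are even. *)
Lemma mean_reflect f : circle_mean (test_reflect f) = circle_mean f.
Proof.
have [m Hm] := mean_dist; rewrite -!Hm -dist_reflectE; congr (dist_fun _ f).
apply: dist_of_fourierE => n; rewrite /fourier !Hm opprK !mean_chi.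
by rewrite oppr_eq0.
Qed.

End CircleMean.

(** * Partitions of unity and functions smooth off a closed set *)

Section LocalSmooth.
Context {R : realType}.
Implicit Types (g : circle R -> R[i]^o) (K : set (circle R)).

Lemma continuous_complex (F1 F2 : R -> R) x :
  {for x, continuous F1} -> {for x, continuous F2} ->
  {for x, continuous (fun x => (F1 x +i* F2 x)%C : R[i]^o)}.
Proof.
move=> c1 c2 A /nbhs_ballP[e /= e0 eA].
have eR : e = (complex.Re e)%:C%C by apply/esym/RRe_real; rewrite realE ltW.
have e0' : 0 < complex.Re e by rewrite eR ltcR in e0.
have e3 : 0 < complex.Re e / 3 by rewrite divr_gt0.
have /cvgrPdist_lt /(_ _ e3) H1 := c1; have /cvgrPdist_lt /(_ _ e3) H2 := c2.
apply: filterS (filterI H1 H2) => y [y1 y2]; apply: eA; rewrite /ball /= eR.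
have := @normc_le R ((F1 x +i* F2 x)%C - (F1 y +i* F2 y)%C) _ (ltW y1) (ltW y2).
move=> /le_lt_trans; apply; rewrite ltcR; lra.
Qed.

Lemma continuous_expi : continuous (@expi R : R -> circle R).
Proof.
move=> x A [_ [[B oB <-] Bx BA]].
have Bn : nbhs (val (expi x) : R[i]^o) B by exact: open_nbhs_nbhs.
have W : nbhs x [set y | B (val (expi y))].
  exact: (@continuous_complex cos sin x (@continuous_cos R x) (@continuous_sin
    R x) _ Bn).
by apply: filterS W => y By; exact: BA.
Qed.

Lemma open_off K : closed K -> open [set x : R | ~ K (expi x)].
Proof.
move=> cK; have -> : [set x : R | ~ K (expi x)] = @expi R @^-1` (~` K) by [].
by apply: open_comp => [x _|]; [exact: continuous_expi|exact: closed_openC].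
Qed.

(** The inner product of [t] with [expi y]: a smooth substitute for the distance to [expi y],
    maximal with value 1 exactly there. *)
Definition arc_dot (y : R) (t : circle R) : R :=
  complex.Re (val t : R[i]) * cos y + complex.Im (val t : R[i]) * sin y.

Lemma arc_dot_expi (y x : R) : arc_dot y (expi x) = cos (x - y).
Proof. by rewrite /arc_dot /= cosB. Qed.

Lemma arc_dot_norm (y : R) (t : circle R) :
  `|(val t : R[i]) - val (expi y)| ^+ 2 = (2 - 2 * arc_dot y t)%:C%C.
Proof.
have [x _ <-] := expi_surj t; rewrite arc_dot_expi chord_norm -rmorphXn /=.
congr (_%:C)%C; rewrite exprMn real_normK ?num_real //.
have {2}-> : x - y = ((x - y) / 2) *+ 2 by rewrite mulr2n; field.
by rewrite cos_mulr2n cos2sin2 mulr2n; ring.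
Qed.

Lemma continuous_arc_dot y : continuous (arc_dot y : circle R -> R).
Proof.
move=> t P /nbhs_ballP[e /= e0 eP].
have e2 : (0 : R[i]) < (e / 3)%:C%C by rewrite ltcR divr_gt0.
pose B : set R[i]^o := ball (val t : R[i]^o) (e / 3)%:C%C.
have nB : nbhs (val t : R[i]^o) B by exact: nbhsx_ballx.
have W : nbhs t [set u | B (val u)].
  exists [set u | B° (val u)]; split; [|exact: nB|].
    by exists B° => //; exact: open_interior.
  by move=> u; exact: interior_subset.
refine (@filterS _ _ (nbhs_filter t) _ _ _ W) => u /ltW Hu; apply: eP;
  rewrite /ball /=.
have H1 := Re_le_normc Hu; have H2 := Im_le_normc Hu.
rewrite /arc_dot; move: H1 H2; rewrite !raddfB /=.
set a := complex.Re _; set b := complex.Re _; set c := complex.Im _;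
  set d := complex.Im _.
move=> H1 H2.
have -> : a * cos y + c * sin y - (b * cos y + d * sin y) = (a - b) * cos y +
  (c - d) * sin y by ring.
apply: le_lt_trans (ler_normD _ _) _; rewrite !normrM.
have h1 : `|a - b| * `|cos y| <= e / 3 * 1 by rewrite ler_pM // cos_max.
have h2 : `|c - d| * `|sin y| <= e / 3 * 1 by rewrite ler_pM // sin_max.
lra.
Qed.

(** As [|t - expi y|^2 = 2 - 2 arc_dot y t], a ball of radius [e] missing [K] contains the set where
    [arc_dot y] is at least [1 - e^2/4]. *)
Lemma separation (K : set (circle R)) (y : R) : closed K -> ~ K (expi y) ->
  exists2 d, 0 < d & forall t, K t -> arc_dot y t < 1 - d.
Proof.
move=> cK Ky.
have oK : open (~` K) by exact: closed_openC.
have [B oB BK] := oK.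
have By : B (val (expi y)) by have : (~` K) (expi y) by []; rewrite -BK.
have /nbhs_ballP[e /= e0 eB] : nbhs (val (expi y) : R[i]^o) B by exact:
  open_nbhs_nbhs.
have eR : e = (complex.Re e)%:C%C by apply/esym/RRe_real; rewrite realE ltW.
have e0' : 0 < complex.Re e by rewrite eR ltcR in e0.
exists (complex.Re e ^+ 2 / 4); first by rewrite divr_gt0 // exprn_gt0.
move=> t Kt; rewrite ltNge; apply/negP => H.
suff : (~` K) t by apply.
rewrite -BK; apply: eB; rewrite /ball /= distrC.
rewrite -(@ltr_pXn2r _ 2) // ?nnegrE // ?ltW //.
rewrite [X in X < _]arc_dot_norm eR -rmorphXn ltcR; nra.
Qed.

Lemma real_test_smooth (F : circle R -> R) : smoothr (fun x => F (expi x)) ->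
  smooth_off set0 (fun t => (F t)%:C%C : R[i]^o).
Proof. by move=> sF; apply/smooth_off0P; split;
  [exact: sF|exact: smoothr_cst]. Qed.

Lemma smoothr_arc_dot y : smoothr (fun x => arc_dot y (expi x)).
Proof.
have [c s] := @smoothr_cos_sin R; rewrite /arc_dot /=.
exact: smoothrD (smoothrM c (@smoothr_cst R (cos y))) (smoothrM s (@smoothr_cst
  R (sin y))).
Qed.

Lemma partition_unity K (u : circle R) : closed K -> ~ K u ->
  exists fa fb : test_fun R, [/\ vanishes_near K fa, vanishes_near [set u] fb &
    forall t, fa t + fb t = 1].
Proof.
have [y _ <-] := expi_surj u => cK Ky.
have [d d0 Kd] := separation cK Ky.
(* [A] lives where [arc_dot y > 1 - d], away from [K], and [B] where [arc_dot y < 1 - d/2], away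
   from [u]. The two regions overlap and cover the circle, so [A + B] can be divided by. *)
pose A t := flat (arc_dot y t - (1 - d)).
pose B t := flat ((1 - d / 2) - arc_dot y t).
have AB t : 0 < A t + B t.
  have [h|h] := ltP (1 - d) (arc_dot y t).
    by rewrite ltr_pwDl ?flat_ge0 // flat_gt0 // subr_gt0.
  by rewrite ltr_wpDl ?flat_ge0 // flat_gt0 //; lra.
have sw := @smoothr_arc_dot y.
have sA : smoothr (fun x => A (expi x)).
  exact: smoothr_comp smoothr_flat (smoothrD sw (@smoothr_cst R (- (1 - d)))).
have sB : smoothr (fun x => B (expi x)).
  exact: smoothr_comp smoothr_flat (smoothrD (@smoothr_cst R (1 - d / 2))
    (smoothrN sw)).
have sI : smoothr (fun x => (A (expi x) + B (expi x))^-1).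
  by apply: (smoothrV (smoothrD sA sB)) => x; rewrite gt_eqF // AB.
exists (test_of (real_test_smooth (F := fun t =>
  A t * (A t + B t)^-1) (smoothrM sA sI))).
exists (test_of (real_test_smooth (F := fun t =>
  B t * (A t + B t)^-1) (smoothrM sB sI))).
have oP (P : set R) : open P -> open (arc_dot y @^-1` P).
  by move=> oP; apply: open_comp => // t _; exact: continuous_arc_dot.
split.
- exists (arc_dot y @^-1` [set r | r < 1 - d]); split.
  + by apply: oP; exact: open_lt.
  + by move=> t /Kd.
  + move=> t /= wt; rewrite /A flat_eq0 ?mul0r //; lra.
- exists (arc_dot y @^-1` [set r | 1 - d / 2 < r]); split.
  + by apply: oP; exact: open_gt.
  + by move=> t -> /=; rewrite arc_dot_expi subrr cos0; lra.
  + move=> t /= wt; rewrite /B flat_eq0 ?mul0r //; lra.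
- move=> t; rewrite -[LHS]/((A t * (A t + B t)^-1)%:C%C + (B t * (A t + B
    t)^-1)%:C%C).
  by rewrite -rmorphD /= -mulrDl mulfV // gt_eqF // AB.
Qed.

Lemma smooth_off_real K g : smooth_off K g <->
  smooth_on [set x | ~ K (expi x)] (reA g) /\ smooth_on [set x | ~ K (expi x)]
    (imA g).
Proof.
split=> [H|[H1 H2] n x Kx]; last by split; [exact: H1|exact: H2].
by split=> n x Kx; [exact: (H n x Kx).1|exact: (H n x Kx).2].
Qed.

Lemma smooth_off_sub K L g : K `<=` L -> smooth_off K g -> smooth_off L g.
Proof. by move=> KL H n x Lx; apply: H => /KL. Qed.

Lemma smooth_offM K g1 g2 : closed K -> smooth_off K g1 -> smooth_off K g2 ->
  smooth_off K (fun t => g1 t * g2 t).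
Proof.
move=> /open_off oU /smooth_off_real[r1 i1] /smooth_off_real[r2 i2].
apply/smooth_off_real; split.
- have -> : reA (fun t => g1 t * g2 t) =
      fun x => reA g1 x * reA g2 x + - (imA g1 x * imA g2 x).
    by apply/funext => x; rewrite /reA /imA; case: (g1 _) (g2 _) => ? ? [? ?].
  exact: (smooth_onD oU (smooth_onM oU r1 r2) (smooth_onN oU (smooth_onM oU i1
    i2))).
- have -> : imA (fun t => g1 t * g2 t) =
      fun x => reA g1 x * imA g2 x + imA g1 x * reA g2 x.
    by apply/funext => x; rewrite /reA /imA; case: (g1 _) (g2 _) => ? ? [? ?].
  exact: (smooth_onD oU (smooth_onM oU r1 i2) (smooth_onM oU i1 r2)).
Qed.

Lemma smooth_offV K g : closed K -> smooth_off K g ->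
  (forall t, ~ K t -> g t != 0) -> smooth_off K (fun t => (g t)^-1).
Proof.
move=> /open_off oU /smooth_off_real[r i] g0.
have N : smooth_on [set x | ~ K (expi x)]
    (fun x => (reA g x * reA g x + imA g x * imA g x)^-1).
  apply: (smooth_onV oU (smooth_onD oU (smooth_onM oU r r) (smooth_onM oU i
    i))).
  move=> x /g0; rewrite eq_complex negb_and -!expr2 -/(reA g x) -/(imA g x) /=
    => H.
  by rewrite paddr_eq0 ?sqr_ge0 // !sqrf_eq0 negb_and.
apply/smooth_off_real; split.
- have -> : reA (fun t => (g t)^-1) =
      fun x => reA g x * (reA g x * reA g x + imA g x * imA g x)^-1.
    by apply/funext => x; rewrite /reA /imA; case: (g _) => ? ? /=;
      rewrite -!expr2.
  exact: (smooth_onM oU r N).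
- have -> : imA (fun t => (g t)^-1) =
      fun x => (- imA g x) * (reA g x * reA g x + imA g x * imA g x)^-1.
    by apply/funext => x; rewrite /reA /imA; case: (g _) => ? ? /=;
      rewrite -!expr2 mulNr.
  exact: (smooth_onM oU (smooth_onN oU i) N).
Qed.

(** Off [K] both factors are smooth; around a point of [K] the product is identically 0, whatever
    the values of [g]. *)
Lemma smooth_mul_vanish K g (f : test_fun R) : closed K -> smooth_off K g ->
  vanishes_near K f -> smooth_off set0 (fun t => g t * f t).
Proof.
move=> cK sg [V [oV KV Vf]] n x _.
have [Kx|Kx] := pselect (K (expi x)); last first.
  apply: (smooth_offM cK sg _ n Kx).
  exact: smooth_off_sub (@sub0set _ K) (test_smooth f).
have oV' : open (@expi R @^-1` V) by apply: open_comp => // y _;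
  exact: continuous_expi.
have Vx : (@expi R @^-1` V) x by exact: KV.
have Z : smooth_on (@expi R @^-1` V) (fun=> 0 :
  R) by exact/smoothr_on/smoothr_cst.
split.
- apply: (smooth_on_eq oV' _ Z) => // y; rewrite inE => Vy.
  by rewrite Vf // mulr0.
- apply: (smooth_on_eq oV' _ Z) => // y; rewrite inE => Vy.
  by rewrite Vf // mulr0.
Qed.

End LocalSmooth.

(** * The distribution sigma *)

Section Sigma.
Context {R : realType}.
Implicit Types (f g h : test_fun R).

Lemma test_mul_bounded g : op_bounded (test_mul g).
Proof.
move=> n.
have T0 : (0 : R) < pi *+ 2 by rewrite mulr2n addr_gt0 // pi_gt0.
have br := periodic_bounded_derivatives T0 (@reA_periodic R g) (@reA_smooth R
  g).
have bi := periodic_bounded_derivatives T0 (@imA_periodic R g) (@imA_smooth R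
  g).
have [C C0 HC] := smallM n (@reA_smooth R g) br.
have [D D0 HD] := smallM n (@imA_smooth R g) bi.
exists n; exists (C + D + 1); first by lra.
move=> d h d0 [H1 H2]; have CD : C * d + D * d <= (C + D + 1) * d by nra.
have Hrr := HC _ _ (@reA_smooth R h) H1;
  have Hri := HC _ _ (@imA_smooth R h) H2.
have Hir := HD _ _ (@reA_smooth R h) H1;
  have Hii := HD _ _ (@imA_smooth R h) H2.
have srr := smoothrM (@reA_smooth R g) (@reA_smooth R h).
have sri := smoothrM (@reA_smooth R g) (@imA_smooth R h).
have sir := smoothrM (@imA_smooth R g) (@reA_smooth R h).
have sii := smoothrM (@imA_smooth R g) (@imA_smooth R h).
split.
- have -> : reA (test_mul g h) = fun x =>
    reA g x * reA h x + - (imA g x * imA h x).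
    by apply/funext => x; rewrite /reA /imA /=; case: (g _) (h _) => ? ? [? ?].
  exact: smallW (leqnn n) CD (smallD srr (smoothrN sii) Hrr (smallN sii Hii)).
- have -> : imA (test_mul g h) = fun x => reA g x * imA h x + imA g x * reA h x.
    by apply/funext => x; rewrite /reA /imA /=; case: (g _) (h _) => ? ? [? ?].
  exact: smallW (leqnn n) CD (smallD sri sir Hri Hir).
Qed.

Lemma test_mul_linear g : linear (test_mul g).
Proof. by move=> c f h; apply: test_eqP => t /=; rewrite mulrDr mulrCA. Qed.

Lemma arc_dot_lt1 (y : R) (t : circle R) : t <> expi y -> arc_dot y t < 1.
Proof.
move=> t1; rewrite ltNge; apply/negP => H.
have H2 : `|(val t : R[i]) - val (expi y)| ^+ 2 <= 0.
  by rewrite arc_dot_norm lecR; lra.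
apply: t1; apply: circle_eqP; apply/eqP.
rewrite -subr_eq0 -normr_eq0 -sqrf_eq0 eq_le H2 /=.
by rewrite exprn_ge0.
Qed.

(** Two points are separated by a level of [arc_dot] halfway between its values there. This is what
    makes points and compact sets closed. *)
Lemma circle_hausdorff : hausdorff_space (circle R).
Proof.
rewrite open_hausdorff => u t /eqP ut; have [y _ yu] := expi_surj u.
have wt : arc_dot y t < 1 by apply: arc_dot_lt1; rewrite yu; exact: nesym.
pose m := (1 + arc_dot y t) / 2.
exists (arc_dot y @^-1` [set r | m < r], arc_dot y @^-1` [set r | r < m]) => /=.
  split; rewrite inE /= /m; last by lra.
  by rewrite -yu arc_dot_expi subrr cos0; lra.
split.
- by apply: open_comp => [v _|]; [exact: continuous_arc_dot|exact: open_gt].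
- by apply: open_comp => [v _|]; [exact: continuous_arc_dot|exact: open_lt].
- by apply/eqP/seteqP; split => // v [/= h1 h2]; move: (lt_trans h1 h2);
    rewrite ltxx.
Qed.

Lemma closed_one : closed [set (circle_one : circle R)].
Proof. exact/accessible_closed_set1/hausdorff_accessible/circle_hausdorff. Qed.

(* The smooth part (1 + t) / (1 - t) of sigma, with junk value 0 at t = 1. *)
Definition sfun (t : circle R) : R[i]^o := (1 + val t) * (1 - val t)^-1.

Lemma sub1_neq0 (t : circle R) : t <> circle_one -> (1 - val t : R[i]) != 0.
Proof.
move=> t1; rewrite subr_eq0 eq_sym; apply/eqP => H; apply: t1.
exact: circle_eqP.
Qed.

Lemma sfun_smooth : smooth_off [set circle_one] sfun.
Proof.
apply: (smooth_offM closed_one).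
  apply: (smooth_off_sub (@sub0set _ _)).
  exact: smoothD (smooth_cst _) smooth_val.
apply: (smooth_offV closed_one); last by move=> t /= /sub1_neq0.
apply: (smooth_off_sub (@sub0set _ _)).
have -> : (fun t : circle R => 1 - val t) = (fun t => 1 + (-1) * val t).
  by apply/funext => t; rewrite mulN1r.
exact: smoothD (smooth_cst _) (smoothM (smooth_cst _) smooth_val).
Qed.

Lemma sfun_reflect t : sfun (circle_inv t) = - sfun t.
Proof.
rewrite /sfun /=; have t0 := circle_neq0 t;
  have [->|t1] := pselect (t = circle_one).
  by rewrite /= invr1 subrr invr0 !mulr0 oppr0.
have n1 := sub1_neq0 t1.
have n2 : (val t : R[i]) - 1 != 0 by rewrite -opprB oppr_eq0.
have E : (1 : R[i]) - (val t)^-1 = (val t - 1) / val t by rewrite mulrBl mul1r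
  divff.
have E2 : (1 : R[i]) + (val t)^-1 = (val t + 1) / val t by rewrite mulrDl mul1r
  divff.
rewrite E E2 invfM invrK mulrACA mulVf // mulr1 -[val t - 1]opprB invrN mulrN.
by rewrite [1 + val t]addrC.
Qed.

(** The integrand of the principal value of [sfun] against [f], regularised at the simple pole 1. *)
Definition pvfun f (t : circle R) : R[i]^o := sfun t * (f t - f circle_one).

(** The chordal Lipschitz bound on [f] cancels the pole: 4 from that bound, 2 from the numerator
    [1 + t]. *)
Lemma pvfun_le f (d : R) t : csmall 1 d f -> `|pvfun f t :
  R[i]| <= (8 * d)%:C%C.
Proof.
move=> fd; have d0 : 0 <= d by exact: le_trans (fd.1 0%N 0 isT).
have [->|t1] := pselect (t = circle_one).
  by rewrite /pvfun subrr mulr0 normr0 lecR mulr_ge0.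
rewrite /pvfun normrM /sfun normrM normfV.
have H := csmall_lipschitz t circle_one fd.
have n1 : `|(1 : R[i]) - val t| != 0 by rewrite normr_eq0 sub1_neq0.
have h2 : `|(1 : R[i]) + val t| <= 2.
  by rewrite (le_trans (ler_normD _ _)) // circle_normE normr1.
apply: le_trans (_ : 2 * `|(1 : R[i]) - val t|^-1 *
    ((4 * d)%:C%C * `|(val t : R[i]) - val (circle_one : circle R)|) <= _).
  by apply: ler_pM => //; rewrite ler_wpM2r // invr_ge0.
rewrite [`|val t - _|]distrC.
have -> : (8 * d)%:C%C = 2 * (4 * d)%:C%C :> R[i].
  rewrite -[X in _ = X * _](rmorph_nat (real_complex R)) -rmorphM;
    congr (_%:C)%C.
  by rewrite mulrA -natrM.
by rewrite [X in X <= _](_ : _ = 2 * (4 * d)%:C%C) //; field.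
Qed.

Lemma csmall1_ex f : exists d : R, csmall 1 d f.
Proof.
have T0 : (0 : R) < pi *+ 2 by rewrite mulr2n addr_gt0 // pi_gt0.
have br := periodic_bounded_derivatives T0 (@reA_periodic R f) (@reA_smooth R
  f).
have bi := periodic_bounded_derivatives T0 (@imA_periodic R f) (@imA_smooth R
  f).
have [B0 H0] := br 0%N; have [B1 H1] := br 1%N.
have [C0 I0] := bi 0%N; have [C1 I1] := bi 1%N.
have p0 : 0 <= B0 by exact: le_trans (H0 0).
have p1 : 0 <= B1 by exact: le_trans (H1 0).
have p2 : 0 <= C0 by exact: le_trans (I0 0).
have p3 : 0 <= C1 by exact: le_trans (I1 0).
exists (B0 + B1 + C0 + C1); split=> -[|[|//]] x _.
- by apply: le_trans (H0 x) _; lra.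
- by apply: le_trans (H1 x) _; lra.
- by apply: le_trans (I0 x) _; lra.
- by apply: le_trans (I1 x) _; lra.
Qed.

Lemma pvfun_ctame f : ctame (pvfun f).
Proof.
have [d fd] := csmall1_ex f.
have sp : smooth_off [set circle_one] (pvfun f).
  apply: (smooth_offM closed_one sfun_smooth);
    apply: (smooth_off_sub (@sub0set _ _)).
  exact: smoothD (test_smooth f) (smooth_cst _).
have [r i] := (smooth_off_real _ _).1 sp.
have ne x : x \in `]0, (2 * pi)[%classic -> [set x :
  R | ~ [set circle_one] (expi x)] x.
  by rewrite inE /= in_itv /=; exact: expi_neq1.
split; split.
- move=> x /ne xn; apply/differentiable_continuous/derivable1_diffP;
    exact: (r 0%N).
- by exists (8 * d) => x; exact: Re_le_normc (pvfun_le _ fd).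
- move=> x /ne xn; apply/differentiable_continuous/derivable1_diffP;
    exact: (i 0%N).
- by exists (8 * d) => x; exact: Im_le_normc (pvfun_le _ fd).
Qed.

Definition pv f : R[i]^o := circle_mean (pvfun f).

Lemma pv_linear : linear pv.
Proof.
move=> c f h; rewrite /pv -[RHS](mean_linear c (pvfun_ctame f) (pvfun_ctame h)).
congr circle_mean; apply/funext => t.
by rewrite /pvfun !test_addE !test_scaleE; ring.
Qed.

Lemma pv_bounded : dist_bounded pv.
Proof.
exists 1%N; exists 16 => // d f d0 fd.
have := mean_le (pvfun_ctame f) (fun t => pvfun_le t fd).
by rewrite mulrA -natrM.
Qed.

Definition one_plus : test_fun R := chi 0 + chi 1.
Definition one_minus : test_fun R := chi 0 - chi 1.

Lemma one_plusE (t : circle R) : one_plus t = 1 + val t.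
Proof. by rewrite /one_plus test_addE. Qed.

Lemma one_minusE (t : circle R) : one_minus t = 1 - val t.
Proof. by rewrite /one_minus test_subE. Qed.

(** The identity [(1 - t) sigma = 1 + t] for the principal value, behind both its Fourier
    coefficients and the recurrence of the product. *)
Lemma pv_one_minus h : pv (test_mul one_minus h) = circle_mean (test_mul
  one_plus h).
Proof.
apply: mean_eq1; [exact: pvfun_ctame|exact: test_ctame|] => t t1.
rewrite /pvfun -[test_mul _ _ t]/(one_minus t * h t).
rewrite -[test_mul _ _ circle_one]/(one_minus circle_one * h circle_one).
rewrite !one_minusE subrr mul0r subr0 mulrA /sfun divfK ?sub1_neq0 //.
Qed.

Lemma test_mul_chi (m n : int) :
  test_mul (chi m) (chi n) = chi (m + n) :> test_fun R.
Proof. by apply: test_eqP => t /=; rewrite expfzDr // circle_neq0. Qed.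

Lemma test_mulDl f g h : test_mul (f + g) h = test_mul f h + test_mul g h.
Proof. by apply: test_eqP => t /=; exact: mulrDl. Qed.

Lemma test_mulBl f g h : test_mul (f - g) h = test_mul f h - test_mul g h.
Proof. by apply: test_eqP => t /=; exact: mulrBl. Qed.

(** Applied to characters, [pv_one_minus] gives the consecutive differences, which vanish except
    next to 0; the value at 0 is 0 because [chi 0] is constant. *)
Lemma pv_chi n : pv (chi n) = - (sgz n)%:~R.
Proof.
have mD f h : circle_mean (f + h : test_fun R) = circle_mean f + circle_mean h.
  have := mean_linear 1 (test_ctame f) (test_ctame h); rewrite mul1r => <-.
  by congr circle_mean; apply/funext => t; rewrite mul1r.
have pB f h : pv (f - h) = pv f - pv h.
  by rewrite addrC -scaleN1r pv_linear scaleN1r addrC.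
have S m : pv (chi m) - pv (chi (1 + m)) = (m == 0)%:R + (1 + m == 0)%:R.
  have := pv_one_minus (chi m).
  rewrite /one_minus /one_plus test_mulBl test_mulDl !test_mul_chi add0r.
  by rewrite pB mD !mean_chi.
have pv0 : pv (chi 0) = 0.
  have -> : pv (chi 0) = circle_mean (0 : test_fun R).
    congr circle_mean; apply/funext => t.
    by rewrite /pvfun -[chi 0 t]/(1 : R[i]) -[chi 0 circle_one]/(1 :
      R[i]) subrr mulr0.
  have := mD 0 0; rewrite addr0 => /eqP;
    rewrite -subr_eq0 opprD addNKr oppr_eq0.
  by move/eqP.
elim: n => [|n IH|n IH]; first by rewrite pv0 sgz0 oppr0.
- have := S n%:Z; rewrite -intS (_ : n.+1%:Z == 0 = false) // addr0 IH.
  case: n {IH} => [|n].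
    by rewrite sgz0 oppr0 sub0r => /= /eqP; rewrite eqr_oppLR => /eqP ->.
  by rewrite !gtr0_sgz //= => /eqP; rewrite subr_eq0 => /eqP <-.
- have E : 1 + - n.+1%:Z = - n%:Z by rewrite intS opprD addNKr.
  have := S (- n.+1%:Z); rewrite E IH.
  rewrite !oppr_eq0 (_ : n.+1%:Z == 0 = false) // add0r.
  case: n {IH E} => [|n].
    by rewrite sgz0 oppr0 subr0 ltr0_sgz //= => ->; rewrite rmorphN opprK.
  by rewrite !ltr0_sgz //= => /eqP; rewrite subr_eq0 => /eqP ->.
Qed.

Lemma sigmaE f : sigma f = pv f.
Proof.
have [s Hs] := dist_mk pv_linear pv_bounded.
rewrite -Hs; congr (dist_fun _ f); apply: dist_of_fourierE => n.
by rewrite /fourier Hs pv_chi sgzN rmorphN opprK.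
Qed.

Lemma sigma_smooth_part : smooth_part [set circle_one] sigma sfun.
Proof.
split; first exact: sfun_smooth.
move=> f [U [oU U1 Uf]]; rewrite sigmaE; congr circle_mean; apply/funext => t.
by rewrite /pvfun (Uf circle_one) ?subr0 //; exact: U1.
Qed.

Lemma sigma_reflect f : sigma (test_reflect f) = - sigma f.
Proof.
have -> : sigma f = dist_opp (dist_reflect sigma) f.
  congr (dist_fun _ f); apply: fourier_inj => n.
  rewrite /fourier -[RHS]/(- (dist_reflect sigma (chi (- n)))) dist_reflectE.
  by rewrite test_reflect_chi opprK !sigmaE !pv_chi sgzN rmorphN.
by rewrite -[dist_opp _ f]/(- (dist_reflect sigma f)) opprK dist_reflectE.
Qed.

End Sigma.

(** * Uniqueness of smooth parts *)

Section SmoothParts.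
Context {R : realType}.
Implicit Types (f g h : test_fun R) (K : set (circle R)) (a b c : circle_dist R)
  (s : circle R -> R[i]^o).

Lemma test_meanD f g : circle_mean (fun t =>
  f t + g t) = circle_mean f + circle_mean g.
Proof.
have := mean_linear 1 (test_ctame f) (test_ctame g); rewrite mul1r => <-.
by congr circle_mean; apply/funext => t; rewrite mul1r.
Qed.

Lemma test_meanB f g : circle_mean (fun t =>
  f t - g t) = circle_mean f - circle_mean g.
Proof.
rewrite -[X in _ = _ - X]mul1r -mulNr addrC.
rewrite -(mean_linear (-1) (test_ctame g) (test_ctame f)).
by congr circle_mean; apply/funext => t; rewrite mulN1r addrC.
Qed.

Lemma conj_smooth f : smooth_off set0 (fun t => ((f t)^*)%C : R[i]^o).
Proof.
apply/smooth_off0P; split.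
- have -> : reA (fun t => ((f t)^*)%C : R[i]^o) = reA f.
    by apply/funext => x; rewrite /reA; case: (f _).
  exact: reA_smooth.
- have -> : imA (fun t => ((f t)^*)%C : R[i]^o) = fun x => - imA f x.
    by apply/funext => x; rewrite /imA; case: (f _).
  exact/smoothrN/imA_smooth.
Qed.

Definition test_conj f : test_fun R := test_of (conj_smooth f).

Lemma mean_sqr_eq0 f : circle_mean (test_mul f (test_conj f)) = 0 -> f = 0.
Proof.
move=> H; apply: test_eqP => t; have [x x0 <-] := expi_surj t.
pose G := fun x : R => reA f x * reA f x + imA f x * imA f x.
have GE : G = reA (test_mul f (test_conj f)).
  by apply/funext => y; rewrite /G /reA /imA /=; case: (f _) => ? ? /=; ring.
have sG : smoothr G by rewrite GE; exact: reA_smooth.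
have tG : tame G by rewrite GE; exact: (test_ctame _).1.
have G0 : rmean G = 0.
  by rewrite GE -[LHS]/(complex.Re (circle_mean (test_mul f (test_conj f)))) H.
have := rmean_eq0 (smoothr_continuous sG) tG _ G0.
have Gp y : 0 <= G y by rewrite addr_ge0 // -expr2 sqr_ge0.
rewrite -mulr_natl in x0.
move=> /(_ Gp x x0) /eqP; rewrite /G -!expr2 paddr_eq0 ?sqr_ge0 // !sqrf_eq0.
move=> /andP[/eqP r0 /eqP i0]; move: r0 i0; rewrite /reA /imA test_zeroE.
by case: (f _) => ? ? /= -> ->.
Qed.

Lemma vanishes_near_in K f t : vanishes_near K f -> K t -> f t = 0.
Proof. by move=> [U [_ KU Uf]] /KU; exact: Uf. Qed.

Lemma vanishes_near_mulr K f g :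
  vanishes_near K f -> vanishes_near K (test_mul g f).
Proof.
by move=> [U [oU KU Uf]]; exists U; split => // t Ut /=; rewrite Uf // mulr0.
Qed.

Lemma vanishes_near_mull K f g :
  vanishes_near K f -> vanishes_near K (test_mul f g).
Proof.
by move=> [U [oU KU Uf]]; exists U; split => // t Ut /=; rewrite Uf // mul0r.
Qed.

Lemma vanishes_near_sub K f g : vanishes_near K f -> vanishes_near K g ->
  vanishes_near K (f - g).
Proof.
move=> [U [oU KU Uf]] [V [oV KV Vg]]; exists (U `&` V); split.
- exact: openI.
- by move=> t Kt; split; [exact: KU|exact: KV].
- by move=> t [Ut Vt]; rewrite test_subE Uf // Vg // subrr.
Qed.

Lemma vanishes_near_subset K L f :
  K `<=` L -> vanishes_near L f -> vanishes_near K f.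
Proof.
by move=> KL [U [oU LU Uf]]; exists U; split => //; exact: subset_trans LU.
Qed.

Lemma continuous_circle_inv : continuous (@circle_inv R).
Proof.
move=> t A [_ [[B oB <-] Bt BA]].
have nB : nbhs (val (circle_inv t) : R[i]^o) B by exact: open_nbhs_nbhs.
have /nbhs_ballP[e /= e0 eB] := nB.
pose V : set R[i]^o := ball (val t : R[i]^o) e.
have nV : nbhs (val t : R[i]^o) V by exact: nbhsx_ballx.
exists [set u : circle R | V° (val u)]; split; [|exact: nV|].
  by exists V° => //; exact: open_interior.
move=> u /interior_subset Vu; apply: BA; apply: eB; rewrite /ball /=.
have -> : (val t : R[i])^-1 - (val u)^-1 = - ((val t)^-1 * (val u)^-1 * (val t
  - val u)).
  have t0 := circle_neq0 t; have u0 := circle_neq0 u.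
  by rewrite mulrBr mulrAC mulVf // mul1r -mulrA mulVf // mulr1 opprB.
by rewrite normrN !normrM !normfV !circle_normE invr1 !mul1r.
Qed.

Lemma vanishes_near_reflect K f : circle_sym K -> vanishes_near K f ->
  vanishes_near K (test_reflect f).
Proof.
move=> sK [U [oU KU Uf]]; exists (@circle_inv R @^-1` U); split.
- by apply: open_comp => // t _; exact: continuous_circle_inv.
- by move=> t Kt; apply: KU; rewrite -sK.
- by move=> t; exact: Uf.
Qed.

(** With [p] a cutoff equal to 1 at [t] and [h = (s - s') p], testing against [conj h * p] gives
    [|h|^2] mean zero, so [h = 0]. The smoothness hypotheses bear on the products so that a
    reflected smooth part also qualifies. *)
Lemma smooth_factor_unique K s s' : closed K ->
  (forall f, vanishes_near K f -> smooth_off set0 (fun t => s t * f t)) ->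
  (forall f, vanishes_near K f -> smooth_off set0 (fun t => s' t * f t)) ->
  (forall f, vanishes_near K f ->
    circle_mean (fun t => s t * f t) = circle_mean (fun t => s' t * f t)) ->
  forall t, ~ K t -> s t = s' t.
Proof.
move=> cK S S' E t Kt; have [p [q [pK qt pq]]] := partition_unity cK Kt.
have pt : p t = 1 by rewrite -(pq t) (vanishes_near_in qt) // addr0.
pose h : test_fun R := test_of (S p pK) - test_of (S' p pK).
have hE u : h u = (s u - s' u) * p u by rewrite /h test_subE mulrBl.
pose f := test_mul (test_conj h) p.
have fK : vanishes_near K f by exact: vanishes_near_mulr.
have : h = 0.
  apply: mean_sqr_eq0; have := E f fK => /eqP; rewrite -subr_eq0.
  rewrite -[X in X - _]/(circle_mean (test_of (S f fK))) -[X in _ -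
    X]/(circle_mean (test_of (S' f fK))).
  rewrite -test_meanB => /eqP H; rewrite -[RHS]H; congr circle_mean;
    apply/funext => u.
  rewrite -[LHS]/(h u * ((h u)^*)%C) -[RHS]/(s u * f u - s' u * f u).
  by rewrite -[f u]/(((h u)^*)%C * p u) {1}hE; ring.
move=> /(congr1 (fun f : test_fun R => f t)); rewrite hE pt mulr1 test_zeroE.
by move/eqP; rewrite subr_eq0 => /eqP.
Qed.

Lemma smooth_part_unique K a s s' : closed K -> smooth_part K a s ->
  smooth_part K a s' -> forall t, ~ K t -> s t = s' t.
Proof.
move=> cK [ss sE] [ss' sE']; apply: smooth_factor_unique => // f fK.
- exact: (smooth_mul_vanish cK ss fK).
- exact: (smooth_mul_vanish cK ss' fK).
- by rewrite -sE // -sE'.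
Qed.

Lemma smooth_part_even K a s : closed K -> circle_sym K -> dist_even a ->
  smooth_part K a s -> forall t, ~ K t -> s (circle_inv t) = s t.
Proof.
move=> cK sK ea [ss sE].
have refl f (fK : vanishes_near K f) : (fun t => s (circle_inv t) * f t) =
    test_reflect (test_of (smooth_mul_vanish cK ss (vanishes_near_reflect sK
      fK))).
  by apply/funext => t; rewrite test_reflectE /= circle_invK.
apply: (@smooth_factor_unique K (fun t => s (circle_inv t)) s cK).
- by move=> f fK; rewrite (refl _ fK); exact: test_smooth.
- by move=> f fK; exact: (smooth_mul_vanish cK ss fK).
- move=> f fK; rewrite (refl _ fK) mean_reflect -(sE _ fK).
  rewrite -[LHS]/(circle_mean (fun t => s t * test_reflect f t)) -sE.
    by rewrite -dist_reflectE ea.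
  exact: vanishes_near_reflect.
Qed.

End SmoothParts.

(** * The product with sigma *)

Section Product.
Context {R : realType}.
Implicit Types (f g h : test_fun R) (K : set (circle R)) (a b c :
  circle_dist R).

(** The witness that gives [dist_mul] its meaning: a partition of unity supplies the two smooth
    factors, and multiplication by each is bounded for the seminorms. *)
Lemma dist_mul_sigma_exists K a : closed K -> ~ K circle_one ->
  smooth_outside K a -> exists c, is_dist_mul K [set circle_one] a sigma c.
Proof.
move=> cK K1 [sa Ha]; have [fa [fb [faK fb1 fab]]] := partition_unity cK K1.
pose ga := test_of (smooth_mul_vanish cK Ha.1 faK).
pose gb := test_of (smooth_mul_vanish closed_one sfun_smooth fb1).
have lT : linear (fun h => a (test_mul gb h) + sigma (test_mul ga h) : R[i]^o).
  move=> k h1 h2; rewrite !test_mul_linear !linearP /=.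
  by rewrite -![_ *: _]/(_ * _); ring.
have [c cE] := dist_mk lT (dist_bounded_add
  (dist_bounded_comp (dist_boundedP a) (@test_mul_bounded R gb))
  (dist_bounded_comp (dist_boundedP sigma) (@test_mul_bounded R ga))).
exists c; exists sa, sfun, fa, fb, ga, gb; split => //.
by split => //; exact: sigma_smooth_part.
Qed.

Section Properties.
Context (K : set (circle R)) (a c : circle_dist R).
Context (cK : closed K) (ac : is_dist_mul K [set circle_one] a sigma c).

(** In the first summand [1 - t] clears the pole of the smooth part of sigma; in the second it turns
    sigma into the function [1 + t], whose mean against [sa fa h] is a value of [a]. The cutoffs
    then add up to 1. *)
Lemma dist_mul_one_minus h : c (test_mul one_minus h) = a (test_mul one_plus h).
Proof.
have [sa [sb [fa [fb [ga [gb [[Ha Hb] [faK fb1] fab [gaE gbE] cE]]]]]]] := ac.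
have sbE := smooth_part_unique closed_one Hb sigma_smooth_part.
have fb10 : fb circle_one = 0 by exact: (vanishes_near_in fb1).
have E1 : test_mul gb (test_mul one_minus h) = test_mul fb (test_mul one_plus
  h).
  apply: test_eqP => t; rewrite -[LHS]/(gb t * (one_minus t * h t)).
  rewrite -[RHS]/(fb t * (one_plus t * h t)) gbE one_minusE one_plusE.
  have [->|t1] := pselect (t = circle_one); first by rewrite fb10 mulr0 !mul0r.
  rewrite sbE // /sfun; have n1 := sub1_neq0 t1.
  by field.
have E2 : sigma (test_mul ga (test_mul one_minus h)) = a (test_mul fa (test_mul
  one_plus h)).
  have -> : test_mul ga (test_mul one_minus h) = test_mul one_minus (test_mul
    ga h).
    by apply: test_eqP => t /=; rewrite mulrCA.
  rewrite sigmaE pv_one_minus (Ha.2 _ (vanishes_near_mull _ faK)).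
  congr circle_mean; apply/funext => t.
  rewrite -[LHS]/(one_plus t * (ga t * h t)) gaE.
  by rewrite -[RHS]/(sa t * (fa t * (one_plus t * h t))); ring.
rewrite cE E1 E2 -linearD; congr (dist_fun _ _); apply: test_eqP => t.
rewrite -[LHS]/(fb t * (one_plus t * h t) + fa t * (one_plus t * h t)).
by rewrite -mulrDl addrC fab mul1r.
Qed.

(** The smooth part is the product of the two smooth parts: both summands become integrals of it,
    weighted by [fb] and [fa]. *)
Lemma dist_mul_smooth_outside : smooth_outside (K `|` [set circle_one]) c.
Proof.
have [sa [sb [fa [fb [ga [gb [[Ha Hb] [faK fb1] fab [gaE gbE] cE]]]]]]] := ac.
have sbE := smooth_part_unique closed_one Hb sigma_smooth_part.
have cU : closed (K `|` [set circle_one]) by exact: closedU closed_one.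
exists (fun t => sa t * sb t); split.
  apply: (smooth_offM cU).
  - exact: smooth_off_sub Ha.1.
  - exact: smooth_off_sub Hb.1.
move=> f fKU.
have fK := vanishes_near_subset (@subsetUl _ K [set circle_one]) fKU.
have f1 := vanishes_near_subset (@subsetUr _ K [set circle_one]) fKU.
have gbf := vanishes_near_mulr gb fK; have gaf := vanishes_near_mulr ga f1.
rewrite cE (Ha.2 _ gbf) (Hb.2 _ gaf).
pose p := test_of (smooth_mul_vanish cK Ha.1 gbf).
pose q := test_of (smooth_mul_vanish closed_one Hb.1 gaf).
rewrite -[X in X + _]/(circle_mean p) -[X in _ + X]/(circle_mean q) -test_meanD.
congr circle_mean; apply/funext => t.
rewrite -[LHS]/(sa t * (gb t * f t) + sb t * (ga t * f t)) gaE gbE.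
have := fab t => /(congr1 (fun z => sa t * sb t * f t * z));
  rewrite mulr1 => <-.
by ring.
Qed.

Context (sK : circle_sym K) (ea : dist_even a).

Lemma dist_mul_fourier0 : fourier c 0 = 0.
Proof.
have [sa [sb [fa [fb [ga [gb [[Ha Hb] [faK fb1] fab [gaE gbE] cE]]]]]]] := ac.
have sbE := smooth_part_unique closed_one Hb sigma_smooth_part.
have saE := smooth_part_even cK sK ea Ha.
have fb10 : fb circle_one = 0 by exact: (vanishes_near_in fb1).
have s1 : circle_sym [set (circle_one : circle R)].
  move=> t; split => [->|/= H].
    by apply: circle_eqP; rewrite /= invr1.
  rewrite -(circle_invK t) H; by apply: circle_eqP; rewrite /= invr1.
(* The antisymmetrised cutoff vanishes near 1 as [fb] does, and near [K] because [fa + fb = 1] also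
   makes it the reflection of [fa] minus [fa]. *)
pose d := fb - test_reflect fb.
have dE t : d t = - (fa t - fa (circle_inv t)).
  rewrite /d test_subE test_reflectE.
  have := fab t; have := fab (circle_inv t) => <- /eqP.
  rewrite eq_sym -subr_eq => /eqP;
    move: (fa t) (fb t) (fa _) (fb _) => x y z w H.
  by rewrite -[w](addKr z) addrC; move: H => <-; ring.
have d1 : vanishes_near [set circle_one] d.
  apply: vanishes_near_sub => //; exact: vanishes_near_reflect.
have dK : vanishes_near K d.
  have : vanishes_near K (test_reflect fa - fa).
    apply: vanishes_near_sub => //; exact: vanishes_near_reflect.
  move=> [U [oU KU Uf]]; exists U; split => // t Ut; rewrite dE opprB.
  exact: Uf.
pose p := test_of (smooth_mul_vanish closed_one sfun_smooth d1).
pose q := test_of (smooth_mul_vanish cK Ha.1 dK).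
have gbp : gb + test_reflect gb = p.
  apply: test_eqP => t; rewrite test_addE test_reflectE !gbE.
  rewrite -[RHS]/(sfun t * d t).
  have inv1 : circle_inv circle_one = circle_one :> circle R.
    by apply: circle_eqP; rewrite /= invr1.
  have [->|t1] := pselect (t = circle_one).
    by rewrite inv1 fb10 /sfun subrr invr0 !mulr0 mul0r addr0.
  have t1' : circle_inv t <> circle_one.
    by move=> H; apply: t1; rewrite -(circle_invK t) H inv1.
  by rewrite !sbE // sfun_reflect /d test_subE test_reflectE mulNr mulrBr.
have gaq : ga - test_reflect ga = - q.
  apply: test_eqP => t; rewrite test_subE test_reflectE !gaE test_oppE.
  rewrite -[X in _ = - X]/(sa t * d t) dE.
  (* Evenness of [sa] is known only off [K]; on [K] both values of [fa] are 0, by symmetry of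
     [K]. *)
  have [Kt|Kt] := pselect (K t).
    have z1 : fa t = 0 by exact: (vanishes_near_in faK).
    have z2 : fa (circle_inv t) = 0 by apply: (vanishes_near_in faK);
      rewrite -sK.
    by rewrite z1 z2 !mulr0 subrr oppr0 mulr0 oppr0.
  by rewrite saE // mulrN opprK mulrBr.
(* In the second copy of [c (chi 0)], evenness of [a] replaces [gb] by its reflection, and oddness
   of sigma replaces [ga] by minus its reflection. *)
have c2 : c (chi 0) + c (chi 0) = a p + sigma (- q).
  have mul0 g : test_mul g (chi 0) = g by apply: test_eqP => t; exact: mulr1.
  rewrite cE !mul0 -gbp -gaq linearD.
  have -> : sigma (ga - test_reflect ga) = sigma ga - sigma (test_reflect ga)
    by exact: linearB.
  rewrite sigma_reflect opprK -dist_reflectE ea.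
  by rewrite addrACA.
have dpE : a p = circle_mean (fun t => sa t * p t).
  apply: Ha.2; have [U [oU KU Uf]] := dK; exists U; split => // t Ut.
  by rewrite -[p t]/(sfun t * d t) Uf // mulr0.
have dqE : sigma q = circle_mean (fun t => sfun t * q t).
  apply: sigma_smooth_part.2; have [U [oU KU Uf]] := d1; exists U;
    split => // t Ut.
  by rewrite -[q t]/(sa t * d t) Uf // mulr0.
(* Both [a p] and [sigma q] are the mean of [sa * sfun * d]. *)
have z : c (chi 0) + c (chi 0) = 0.
  rewrite c2; have -> : sigma (- q) = - sigma q by exact: linearN.
  rewrite dpE dqE; apply/eqP; rewrite subr_eq0; apply/eqP; congr circle_mean.
  by apply/funext => t; rewrite -[p t]/(sfun t * d t) -[q t]/(sa t * d t)
    mulrCA.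
rewrite /fourier oppr0; apply/eqP.
by move: z => /eqP; rewrite -mulr2n mulrn_eq0.
Qed.

Lemma dist_mul_fourier_rec n :
  fourier c n - fourier c (n - 1) = fourier a n + fourier a (n - 1).
Proof.
have := dist_mul_one_minus (chi (- n)).
rewrite /one_minus /one_plus test_mulBl test_mulDl !test_mul_chi add0r.
have -> : 1 + - n = - (n - 1) by rewrite opprB.
have -> : c (chi (- n) - chi (- (n - 1))) = c (chi (- n)) - c (chi (- (n - 1)))
  by exact: linearB.
by rewrite linearD.
Qed.

Lemma even_fourier n : fourier a (- n) = fourier a n.
Proof.
by rewrite /fourier opprK -[in RHS]ea dist_reflectE test_reflect_chi opprK.
Qed.

Lemma dist_mul_fourierN n : fourier c (- n) = - fourier c n.
Proof.
(* By evenness of [a], the recurrence at [m] and at [1 - m] has the same right-hand side. *)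
have S (m : int) : fourier c (- m) + fourier c m = fourier c (- (m - 1)) +
  fourier c (m - 1).
  have h1 := dist_mul_fourier_rec m;
    have h2 := dist_mul_fourier_rec (- (m - 1)).
  have e : - (m - 1) - 1 = - m by rewrite opprB addrAC subrr add0r.
  move: h1 h2; rewrite e !even_fourier => h1 h2.
  have : fourier c m - fourier c (m - 1) = fourier c (- (m - 1)) - fourier c (-
    m).
    by rewrite h1 h2 addrC.
  move=> /eqP; rewrite subr_eq addrAC -subr_eq opprK => /eqP <-.
  by rewrite addrC.
have Z (m : int) : fourier c (- m) + fourier c m = 0.
  elim: m => [|m IH|m IH].
  - by rewrite oppr0 dist_mul_fourier0 addr0.
  - by rewrite S -IH intS addrAC subrr add0r.
  - by have := S (- m%:Z); rewrite IH -opprD -(addrC 1) -intS => <-.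
by apply/eqP; rewrite -addr_eq0 Z.
Qed.

Lemma dist_mul_odd : dist_odd c.
Proof.
apply: dist_of_fourierE => n; rewrite dist_mul_fourierN.
by [].
Qed.

End Properties.
End Product.

(** * Determinants *)

Section Determinants.
Context {F : comUnitRingType}.

Lemma det_row_perm_col_perm n (s : 'S_n) (A : 'M[F]_n) :
  \det (row_perm s (col_perm s A)) = \det A.
Proof.
rewrite row_permE col_permE !det_mulmx !det_perm odd_permV.
by rewrite mulrCA -signr_addb addbb expr0 mulr1.
Qed.

(* Block form of a skew-symmetric Toeplitz matrix after reversing its first
   half of indices. *)
Lemma det_toeplitz_hankel_block n (t h : 'M[F]_n) : t^T = - t -> h^T = h ->
  \det (block_mx (- t) (- h) h t) = \det (h - t) ^+ 2.
Proof.
move=> tT hT.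
(* The second block row is added to the first, then the first block column to the second. The
   diagonal blocks obtained, [h - t] and [h + t], are transposes of each other. *)
have E : block_mx 1%:M 1%:M 0 1%:M *m block_mx (- t) (- h) h t *m block_mx 1%:M
  1%:M 0 1%:M =
    block_mx (h - t) 0 h (h + t).
  rewrite !mulmx_block !mul1mx !mulmx1 !mul0mx !mulmx0 !addr0 !add0r.
  congr block_mx; first by rewrite addrC.
  by rewrite addrACA -opprD [h + t]addrC addNr.
have := congr1 determinant E.
rewrite !det_mulmx !det_ublock !det_lblock !det1 !mul1r !mulr1 => ->.
by rewrite expr2; congr (_ * _); rewrite -det_tr linearD /= tT hT.
Qed.

Lemma det_skew_toeplitz (N : nat) (c : int -> F) :
  (forall n, c (- n) = - c n) ->
  \det (\matrix_(j < N + N, k < N + N) c (j%:Z - k%:Z)) =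
  \det (\matrix_(j < N, k < N) (c (j + k + 1)%N%:Z - c (j%:Z - k%:Z))) ^+ 2.
Proof.
move=> cN.
pose t := \matrix_(j < N, k < N) c (j%:Z - k%:Z).
pose h := \matrix_(j < N, k < N) c (j + k + 1)%N%:Z.
have tT : t^T = - t by apply/matrixP => j k; rewrite !mxE -cN opprB.
have hT : h^T = h by apply/matrixP => j k; rewrite !mxE [(k + j)%N]addnC.
have -> : \matrix_(j < N, k < N) (c (j + k + 1)%N%:Z - c (j%:Z - k%:Z)) = h - t.
  by apply/matrixP => j k; rewrite !mxE.
rewrite -(det_toeplitz_hankel_block tT hT).
(* Reversing [j] to [N - 1 - j] in the first half only makes the off-diagonal index differences
   equal to [-(j + k + 1)] and [j + k + 1], which creates the Hankel blocks. *)
pose r (i : 'I_(N + N)) : 'I_(N + N) :=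
  match fintype.split i with inl j => lshift N (rev_ord j) | inr j =>
    rshift N j end.
have rr : involutive r.
  move=> i; rewrite /r; case: (split_ordP i) => j ->.
    by rewrite (unsplitK (inl _)) rev_ordK.
  by rewrite (unsplitK (inr _)).
have rinj : injective r by exact: inv_inj.
rewrite -(det_row_perm_col_perm (perm rinj)); congr determinant.
apply/matrixP => j k; rewrite [LHS]mxE [LHS]mxE [LHS]mxE !permE.
rewrite /r; case: (split_ordP j) => j' ->; case: (split_ordP k) => k' ->.
all: rewrite ?(unsplitK (inl _)) ?(unsplitK (inr _)) ?block_mxEul ?block_mxEur
  ?block_mxEdl ?block_mxEdr !mxE -?cN.
all: have := ltn_ord j'; have := ltn_ord k' => hk hj.
all: congr c; rewrite /=; lia.
Qed.

(** Summing the recurrence from [j - k] up to [j + k + 1] uses every inner [a] twice and the two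
    extreme ones once. Column [k] is thus a combination of columns [0] to [k] of [M], with
    coefficient 1 for the last and 2 for the others. *)
Lemma det_toeplitz_hankel_telescope (N : nat) (a c : int -> F) :
  (forall n, c n - c (n - 1) = a n + a (n - 1)) ->
  \det (\matrix_(j < N, k < N) (c (j + k + 1)%N%:Z - c (j%:Z - k%:Z))) =
  \det (\matrix_(j < N, k < N) (a (j%:Z - k%:Z) + a (j + k + 1)%N%:Z)).
Proof.
move=> ca.
pose M := \matrix_(j < N, k < N) (a (j%:Z - k%:Z) + a (j + k + 1)%N%:Z).
pose U : 'M[F]_N := \matrix_(l < N, k < N) ((l <= k)%N%:R + (l < k)%N%:R).
have Utrig : is_trig_mx U^T.
  by apply/is_trig_mxP => i j ij; rewrite !mxE leqNgt ij ltnNge (ltnW ij) addr0.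
have detU : \det U = 1.
  rewrite -det_tr det_trig //; apply: big1 => i _.
  by rewrite !mxE leqnn ltnn addr0.
have -> : \matrix_(j < N, k < N) (c (j + k + 1)%N%:Z - c (j%:Z - k%:Z)) = M *m
  U.
  apply/matrixP => j k; rewrite !mxE.
  pose m (l : nat) := a (j%:Z - l%:Z) + a (j + l + 1)%N%:Z.
  (* Each step widens the range by one at both ends, adding the recurrences at [j + n + 2] and
     [j - n], that is [m n.+1 + m n]. *)
  have T (n : nat) : c (j + n + 1)%N%:Z - c (j%:Z - n%:Z) =
      \sum_(0 <= l < n.+1) m l + \sum_(0 <= l < n) m l.
    elim: n => [|n IH].
      rewrite big_nat1 big_geq // addr0 /m addn0 subr0.
      have := ca (j + 1)%N%:Z; have -> : (j + 1)%N%:Z - 1 = j%:Z by lia.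
      by move=> ->; rewrite addr0 addrC.
    rewrite [X in _ = X + _]big_nat_recr //= [X in _ = _ + X]big_nat_recr //=
      addrACA -IH /m.
    have h1 := ca (j + n.+1 + 1)%N%:Z.
    have h2 := ca (j%:Z - n%:Z).
    have e1 : (j + n.+1 + 1)%N%:Z - 1 = (j + n + 1)%N%:Z by lia.
    have e2 : j%:Z - n%:Z - 1 = j%:Z - n.+1%:Z by lia.
    rewrite e1 in h1; rewrite e2 in h2.
    have -> : c (j + n.+1 + 1)%N%:Z = a (j + n.+1 + 1)%N%:Z + a (j + n +
      1)%N%:Z + c (j + n + 1)%N%:Z.
      by rewrite -h1 subrK.
    have -> : c (j%:Z - n%:Z) = a (j%:Z - n%:Z) + a (j%:Z - n.+1%:Z) + c (j%:Z
      - n.+1%:Z).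
      by rewrite -h2 subrK.
    by ring.
  rewrite T.
  have cut (n : nat) : (n <= N)%N -> \sum_(0 <= l < n) m l = \sum_(l < N) m l *
    (l < n)%N%:R.
    move=> nN; rewrite big_mkord (big_ord_widen _ (fun l =>
      m l) nN) big_mkcond /=.
    by apply: eq_bigr => l _; case: ifP => _; rewrite ?mulr1 ?mulr0.
  rewrite !cut //; last by rewrite ltnW.
  rewrite -big_split; apply: eq_bigr => l _ /=.
  by rewrite !mxE -mulrDr ltnS.
by rewrite det_mulmx detU mulr1.
Qed.

End Determinants.

Theorem theorem3p3 (R : realType) (K : set (circle R)) (a : circle_dist R) :
  compact K -> circle_sym K -> K `<=` ~` [set circle_one] ->
  smooth_outside K a -> dist_even a ->
  let c := dist_mul K [set circle_one] a sigma in
  (forall N : nat, (1 <= N)%N ->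
     \det (toeplitz_mx (2 * N) c) = \det (toeplitz_hankel_mx N a) ^+ 2) /\
  smooth_outside (K `|` [set circle_one]) c /\ dist_odd c.
Proof.
move=> compK sK K1' sa ea c.
have cK : closed K by apply: compact_closed compK; exact: circle_hausdorff.
have K1 : ~ K circle_one by move=> /K1'; exact.
have ac : is_dist_mul K [set circle_one] a sigma c.
  exact: (xgetPex dist_zero (dist_mul_sigma_exists cK K1 sa)).
split; last first.
  split; first exact: (dist_mul_smooth_outside cK ac).
  exact: (dist_mul_odd cK ac sK ea).
move=> N _; rewrite mul2n -addnn /toeplitz_mx det_skew_toeplitz; last first.
  exact: (dist_mul_fourierN cK ac sK ea).
rewrite (det_toeplitz_hankel_telescope _ (dist_mul_fourier_rec ac)).
by congr (\det _ ^+ 2); apply/matrixP => j k; rewrite !mxE.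
Qed.
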